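(* Let $g:\mathbb{Z}\setminus\{0\}\to\mathbb{C}$ satisfy $g(m)=o(1/m)$ as $|m|\to\infty$, let $k$ be a positive integer and $a\in\mathbb{R}\setminus\{0\}$. For integers $0\le l\le j$ put $S(j,l):=\sum_{(r_0,\dots,r_l)\in\mathbb{N}_0^{l+1},\ r_0+\cdots+r_l=j-l}\prod_{h=0}^{l}(2h+1)^{2r_h}$. Then $$\sum_{m,n\in\mathbb{Z},\,m\neq 0}\frac{g(m)}{(m+ani)^{2k}}=\frac{\pi^{2k}}{a^{2k}(2k-1)!}\sum_{1\le l\le j\le k}\left\{\binom{2k}{2j}(2l-1)!-\binom{2k}{2j+1}(2l-1)!(2l+1)\right\}S(j,l)\sum_{m=1}^\infty\frac{g(m)+g(-m)}{\sinh^{2l}(m\pi/a)},$$ $$\sum_{m,n\in\mathbb{Z},\,m\neq 0}\frac{g(m)}{(m+ani)^{2k+1}}=\frac{\pi^{2k+1}}{a^{2k+1}(2k)!}\sum_{0\le l\le j\le k}\left\{\binom{2k}{2j}(2l)!-\binom{2k}{2j+1}(2l+1)!\right\}S(j,l)\sum_{m=1}^\infty\frac{\big(g(m)-g(-m)\big)\cosh(m\pi/a)}{\sinh^{2l+1}(m\pi/a)}.$$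
   Context: $i=\sqrt{-1}$, $\mathbb{N}_0$ is the set of nonnegative integers; $\binom{n}{k}=\frac{n!}{k!(n-k)!}$ for $0\le k\le n$ and $\binom{n}{k}=0$ if $k>n$. A double sum $\sum_{m,n\in\mathbb{Z},\,m\neq0}F(m,n)$ means the iterated sum $\sum_{m\in\mathbb{Z}\setminus\{0\}}\sum_{n\in\mathbb{Z}}F(m,n)$.
   Formalization: In the second formula the l=0 series, sum of (g(m)-g(-m))coth(m pi/a), may diverge under g(m)=o(1/m), e.g. g(m)=1/(m log(|m|+1)); its convergence is not claimed, and a divergent one is given an arbitrary value, which does not matter as its total coefficient is 0. *)

(* Defs.v *)
From Stdlib Require Import Reals ZArith Arith List FinFun Lia Lra.
From Coquelicot Require Import Coquelicot.
Import ListNotations.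
Open Scope R_scope.

(* [Stdlib.Reals.Binomial.C n k] does not vanish for [k > n]. *)
Definition binom (n k : nat) : R :=
  if (k <=? n)%nat
  then INR (fact n) / (INR (fact k) * INR (fact (n - k)))
  else 0.

(* The value at [0] is unconstrained, so a function on the nonzero integers is
   represented by any of its extensions to [Z]. *)
Definition little_o_inv (g : Z -> C) : Prop :=
  forall eps : R, 0 < eps ->
  exists M : R, forall m : Z, m <> 0%Z -> M <= Rabs (IZR m) ->
    Cmod (g m) <= eps * Rabs (/ IZR m).

(* Sums over [Z] and over [Z \ {0}]: both one-sided series must converge. *)
Definition is_series_Z (u : Z -> C) (s : C) : Prop :=
  exists s1 s2 : C,
    is_series (fun n : nat => u (Z.of_nat n)) s1 /\
    is_series (fun n : nat => u (- Z.of_nat (S n))%Z) s2 /\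
    s = (s1 + s2)%C.

Definition is_series_Znz (u : Z -> C) (s : C) : Prop :=
  exists s1 s2 : C,
    is_series (fun n : nat => u (Z.of_nat (S n))) s1 /\
    is_series (fun n : nat => u (- Z.of_nat (S n))%Z) s2 /\
    s = (s1 + s2)%C.

Definition is_iterated_sum (F : Z -> Z -> C) (s : C) : Prop :=
  exists inner : Z -> C,
    (forall m : Z, m <> 0%Z -> is_series_Z (F m) (inner m)) /\
    is_series_Znz inner s.

(* Total complex counterpart of [Series], with a junk value on divergent series.
   The hypothesis on [g] does not make [sum_m (g m - g (-m)) coth (m pi / a)]
   convergent, but that series (the case [l = 0] of the odd formula) occurs with
   total coefficient
   [sum_j (binom (2k) (2j) - binom (2k) (2j+1)) * S(j,0) = (1 - 1)^(2k) = 0]. *)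
Definition CSeries (u : nat -> C) : C :=
  (Series (fun n => Re (u n)), Series (fun n => Im (u n))).

Lemma CSeries_unique (u : nat -> C) (s : C) : is_series u s -> CSeries u = s.
Proof.
  intros H.
  assert (E : forall n, sum_n u n =
    (sum_n (fun i => Re (u i)) n, sum_n (fun i => Im (u i)) n)).
  { induction n as [|n IH].
    - rewrite !sum_O. apply surjective_pairing.
    - rewrite !sum_Sn, IH. reflexivity. }
  destruct s as [x y]. unfold CSeries. f_equal.
  - apply is_series_unique. intros P [e He].
    destruct (H (fun z => P (fst z))) as [N HN].
    + exists e. intros z [Hz _]. now apply He.
    + exists N. intros n Hn. specialize (HN n Hn). now rewrite E in HN.
  - apply is_series_unique. intros P [e He].
    destruct (H (fun z => P (snd z))) as [N HN].
    + exists e. intros z [_ Hz]. now apply He.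
    + exists N. intros n Hn. specialize (HN n Hn). now rewrite E in HN.
Qed.

(* All [r] in [N_0^len] with [r_0 + ... + r_(len-1) = total], each listed once. *)
Fixpoint tuples_of_sum (len total : nat) : list (list nat) :=
  match len with
  | O => match total with O => [[]] | S _ => [] end
  | S len' =>
      flat_map (fun r => map (cons r) (tuples_of_sum len' (total - r)))
               (seq 0 (S total))
  end.

Lemma in_tuples_of_sum (len total : nat) (r : list nat) :
  In r (tuples_of_sum len total) <-> length r = len /\ list_sum r = total.
Proof.
  revert total r; induction len as [|len IH]; intros total r; cbn [tuples_of_sum].
  - destruct total as [|t]; destruct r as [|x r]; simpl; split;
      try tauto; try (intros [H|[]]; discriminate); intros [H1 H2];
      try discriminate.
  - rewrite in_flat_map. split.
    + intros [x [Hx Hr]]. apply in_seq in Hx. apply in_map_iff in Hr.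
      destruct Hr as [r' [<- Hr']]. apply IH in Hr'. destruct Hr' as [H1 H2].
      change (list_sum (x :: r')) with (x + list_sum r')%nat. simpl length. lia.
    + intros [H1 H2]. destruct r as [|x r]; [discriminate|].
      change (list_sum (x :: r)) with (x + list_sum r)%nat in H2.
      injection H1 as H1.
      exists x. split; [apply in_seq; lia|].
      apply in_map. apply IH. lia.
Qed.

Lemma NoDup_tuples_of_sum (len total : nat) : NoDup (tuples_of_sum len total).
Proof.
  revert total; induction len as [|len IH]; intros total; cbn [tuples_of_sum].
  - destruct total; repeat constructor; simpl; tauto.
  - generalize (seq_NoDup (S total) 0). generalize (seq 0 (S total)).
    induction l as [|x l IHl]; intros H; simpl; [constructor|].
    inversion H as [|? ? Hx Hl]; subst. apply NoDup_app.
    + apply Injective_map_NoDup; [|apply IH].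
      intros u v E. now injection E.
    + now apply IHl.
    + intros r Hr Hr'. apply in_map_iff in Hr. destruct Hr as [u [<- _]].
      apply in_flat_map in Hr'. destruct Hr' as [y [Hy Hr']].
      apply in_map_iff in Hr'. destruct Hr' as [v [E _]].
      injection E as E _. now subst y.
Qed.

(* [prod_h (2 h + 1)^(2 r_h)], the index of the head of the list being [h]. *)
Fixpoint odd_power_prod (h : nat) (r : list nat) : R :=
  match r with
  | [] => 1
  | r0 :: r' => INR (2 * h + 1) ^ (2 * r0) * odd_power_prod (S h) r'
  end.

Definition Sjl (j l : nat) : R :=
  fold_right Rplus 0
    (map (odd_power_prod 0) (tuples_of_sum (S l) (j - l))).

(* Main.v *)
Require Import Defs.
From Stdlib Require Import Reals ZArith List Lia Lra.
From Coquelicot Require Import Coquelicot.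
Open Scope R_scope.

(** With [x = m pi / a], the inner sum over [n] is [(pi / a)^p] times
    [sum_n (x + i pi n)^(-p) = (-1)^(p-1) coth^((p-1)) x / (p-1)!].

    The closed form of the derivatives of [coth] is obtained by differentiating
    [cosh / sinh^(2 l + 1)] and [1 / sinh^(2 l)]: the coefficients then satisfy a
    two-term recurrence, which the sums of binomials times [S(j, l)] satisfy as well
    because [S(j, l)] is the complete homogeneous symmetric polynomial of degree
    [j - l] in [1, 9, ..., (2 l + 1)^2].

    The partial fractions start from the product formula for [sinh]. The integrals
    [I_n(c)] of [cosh (c t) cos^n t] over [[0, pi/2]] satisfy
    [(c^2 + (n+2)^2) I_(n+2) = (n+2) (n+1) I_n], and [I_n(c) / I_n(0)] tends to [1],
    whence [ln (sinh x / x) = sum_n ln (1 + x^2 / (pi n)^2)] for [x > 0]; this series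
    is then differentiated [p] times term by term.

    Finally [1 / sinh^(2 l)] and [cosh / sinh^(2 l + 1)] are [O(1 / m^2)] for
    [l >= 1], so the boundedness of [g] suffices for the outer sum. *)

(** * Coefficients *)

(** [Sjl] with a free starting index: removing the first entry of a tuple shifts the bases of the
    others, so inductions need [h] to vary. This is the complete homogeneous symmetric polynomial of
    degree [d] in [(2 h + 1)^2, ..., (2 (h + len) - 1)^2]. *)
Definition odd_power_sum (h len d : nat) : R :=
  fold_right Rplus 0 (map (odd_power_prod h) (tuples_of_sum len d)).

Lemma fold_right_Rplus_app (l1 l2 : list R) :
  fold_right Rplus 0 (l1 ++ l2) = fold_right Rplus 0 l1 + fold_right Rplus 0 l2.
Proof. induction l1 as [|x l1 IH]; simpl; [ring | rewrite IH; ring]. Qed.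

Lemma fold_right_Rplus_scal {A : Type} (c : R) (f : A -> R) (l : list A) :
  fold_right Rplus 0 (map (fun x => c * f x) l) = c * fold_right Rplus 0 (map f l).
Proof. induction l as [|x l IH]; simpl; [ring | rewrite IH; ring]. Qed.

Lemma odd_power_sum_cons (h len d : nat) :
  odd_power_sum h (S len) d =
  fold_right Rplus 0
    (map (fun r => INR (2 * h + 1) ^ (2 * r) * odd_power_sum (S h) len (d - r))
       (seq 0 (S d))).
Proof.
  unfold odd_power_sum at 1. cbn [tuples_of_sum].
  induction (seq 0 (S d)) as [|r s IH]; [reflexivity|].
  cbn [flat_map]. rewrite map_app, fold_right_Rplus_app, IH, map_map.
  cbn [map fold_right odd_power_prod]. f_equal.
  apply fold_right_Rplus_scal.
Qed.

Lemma odd_power_sum_0 (h len : nat) : odd_power_sum h len 0 = 1.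
Proof.
  revert h; induction len as [|len IH]; intros h.
  - unfold odd_power_sum. simpl. ring.
  - rewrite odd_power_sum_cons. cbn [seq map fold_right].
    replace (0 - 0)%nat with 0%nat by lia. rewrite IH. simpl. ring.
Qed.

(** Splits the tuples by their first entry: if it is positive, one factor [(2 h + 1)^2] comes out;
    if it is zero, the first variable disappears. *)
Lemma odd_power_sum_head (h len d : nat) :
  odd_power_sum h (S len) (S d) =
  INR (2 * h + 1) ^ 2 * odd_power_sum h (S len) d + odd_power_sum (S h) len (S d).
Proof.
  rewrite (odd_power_sum_cons h len (S d)), (odd_power_sum_cons h len d).
  rewrite (eq_refl : seq 0 (S (S d)) = 0%nat :: seq 1 (S d)), <- seq_shift.
  cbn [map fold_right]. rewrite map_map, <- fold_right_Rplus_scal, Rplus_comm.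
  f_equal.
  - f_equal. apply map_ext. intros r.
    replace (2 * S r)%nat with (2 + 2 * r)%nat by lia.
    rewrite pow_add. simpl (S d - S r)%nat. ring.
  - replace (2 * 0)%nat with 0%nat by lia. rewrite Nat.sub_0_r. simpl. ring.
Qed.

(** The same splitting at the last variable. Tuples are enumerated from the front, so it is derived
    from [odd_power_sum_head] by induction on [len] and then on [d]. *)
Lemma odd_power_sum_tail (h len d : nat) :
  odd_power_sum h (S len) (S d) =
  INR (2 * (h + len) + 1) ^ 2 * odd_power_sum h (S len) d + odd_power_sum h len (S d).
Proof.
  revert h d; induction len as [|len IHlen]; intros h d.
  - rewrite odd_power_sum_head, Nat.add_0_r. reflexivity.
  - replace (h + S len)%nat with (S h + len)%nat by lia.
    induction d as [|d IHd].
    + rewrite odd_power_sum_head, (odd_power_sum_head h len), IHlen.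
      rewrite !odd_power_sum_0. ring.
    + rewrite (odd_power_sum_head h (S len) (S d)), IHlen.
      rewrite (odd_power_sum_head h len (S d)).
      rewrite (odd_power_sum_head h (S len) d) in IHd |- *.
      (* After this multiplication the products in the hypothesis and in the goal are the same
         atoms, and the identity is linear in them. *)
      apply (f_equal (Rmult (INR (2 * h + 1) ^ 2))) in IHd.
      lra.
Qed.

(* [Sjl] returns [1] for [l > j], because [j - l] truncates. *)
Definition S_ext (j l : nat) : R := if (l <=? j)%nat then Sjl j l else 0.

Lemma S_ext_le (j l : nat) : (l <= j)%nat -> S_ext j l = Sjl j l.
Proof. intros H. unfold S_ext. now rewrite (proj2 (Nat.leb_le l j) H). Qed.

Lemma S_ext_gt (j l : nat) : (j < l)%nat -> S_ext j l = 0.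
Proof. intros H. unfold S_ext. now rewrite (proj2 (Nat.leb_gt l j) H). Qed.

Lemma Sjl_diag (j : nat) : Sjl j j = 1.
Proof. unfold Sjl. rewrite Nat.sub_diag. apply (odd_power_sum_0 0 (S j)). Qed.

Lemma S_ext_0_r (j : nat) : S_ext j 0 = 1.
Proof.
  rewrite S_ext_le by lia. unfold Sjl. rewrite Nat.sub_0_r.
  change (odd_power_sum 0 1 j = 1).
  induction j as [|j IH]; [apply odd_power_sum_0|].
  rewrite odd_power_sum_tail, IH. unfold odd_power_sum. simpl. ring.
Qed.

(** The last variable of [Sjl (S j) (S l)] is [(2 l + 3)^2], and [odd_power_sum_tail] splits it off.
    The value 0 for [l > j] makes the recurrence hold for all indices. *)
Lemma S_ext_rec (j l : nat) :
  S_ext (S j) (S l) = INR (2 * S l + 1) ^ 2 * S_ext j (S l) + S_ext j l.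
Proof.
  destruct (lt_eq_lt_dec j l) as [[H|H]|H].
  - rewrite !S_ext_gt by lia. ring.
  - subst l. rewrite (S_ext_gt j (S j)), !S_ext_le, !Sjl_diag by lia. ring.
  - rewrite !S_ext_le by lia. unfold Sjl.
    replace (S j - S l)%nat with (S (j - S l)) by lia.
    replace (j - l)%nat with (S (j - S l)) by lia.
    apply (odd_power_sum_tail 0 (S l)).
Qed.

(** * Binomial coefficients *)

Lemma binom_0_r (n : nat) : binom n 0 = 1.
Proof.
  unfold binom. simpl. rewrite Nat.sub_0_r. field. apply INR_fact_neq_0.
Qed.

Lemma binom_gt (n i : nat) : (n < i)%nat -> binom n i = 0.
Proof. intros H. unfold binom. now rewrite (proj2 (Nat.leb_gt i n) H). Qed.

Lemma binom_le (n i : nat) : (i <= n)%nat -> binom n i = Binomial.C n i.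
Proof. intros H. unfold binom. now rewrite (proj2 (Nat.leb_le i n) H). Qed.

Lemma binom_diag (n : nat) : binom n n = 1.
Proof.
  rewrite binom_le by lia. unfold Binomial.C. rewrite Nat.sub_diag. simpl. field.
  apply INR_fact_neq_0.
Qed.

Lemma binom_pascal (n i : nat) : binom (S n) (S i) = binom n i + binom n (S i).
Proof.
  destruct (lt_eq_lt_dec i n) as [[H|H]|H].
  - rewrite !binom_le by lia. symmetry. now apply pascal.
  - subst i. rewrite (binom_gt n (S n)), !binom_diag by lia. ring.
  - rewrite !binom_gt by lia. ring.
Qed.

Lemma binom_pascal2 (n i : nat) :
  binom (S (S n)) (S (S i)) = binom n i + 2 * binom n (S i) + binom n (S (S i)).
Proof. rewrite !binom_pascal. ring. Qed.

Lemma sum_Sn_R (u : nat -> R) (n : nat) :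
  (sum_n u (S n) : R) = sum_n u n + u (S n).
Proof. apply (sum_Sn u n). Qed.

Lemma sum_O_R (u : nat -> R) : (sum_n u 0 : R) = u 0%nat.
Proof. apply (sum_O u). Qed.

(** The braces of both formulas are multiples of this number: by [(2 l - 1)!] for the even exponent,
    by [(2 l)!] for the odd one. *)
Definition coth_weight (k l j : nat) : R :=
  binom (2 * k) (2 * j) - INR (2 * l + 1) * binom (2 * k) (2 * j + 1).

(* [coth_coef k l * (2 l)!] is the coefficient of [cosh / sinh^(2 l + 1)] in the
   [2 k]-th derivative of [coth]. *)
Definition coth_coef (k l : nat) : R := sum_n (fun j => coth_weight k l j * S_ext j l) k.

Lemma coth_coef_extend (k l : nat) :
  coth_coef k l = sum_n (fun j => coth_weight k l j * S_ext j l) (S k).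
Proof.
  rewrite sum_Sn_R. fold (coth_coef k l). unfold coth_weight.
  rewrite !(binom_gt (2 * k)) by lia. ring.
Qed.

Lemma coth_weight_succ (k l j : nat) :
  coth_weight (S k) l (S j) =
  binom (2 * k) (2 * j) - INR (2 * l + 1) * binom (2 * k) (2 * j + 1)
  + 2 * binom (2 * k) (2 * j + 1) + binom (2 * k) (2 * j + 2)
  - INR (2 * l + 1) * (2 * binom (2 * k) (2 * j + 2) + binom (2 * k) (2 * j + 3)).
Proof.
  unfold coth_weight.
  replace (2 * S k)%nat with (S (S (2 * k))) by lia.
  replace (2 * S j + 1)%nat with (S (S (2 * j + 1))) by lia.
  replace (2 * S j)%nat with (S (S (2 * j))) by lia.
  rewrite !binom_pascal2.
  replace (2 * j + 1)%nat with (S (2 * j)) by lia.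
  replace (2 * j + 2)%nat with (S (S (2 * j))) by lia.
  replace (2 * j + 3)%nat with (S (S (S (2 * j)))) by lia. ring.
Qed.

(** Two derivatives turn [(2 l)! cosh / sinh^(2 l + 1)] into [4 l^2 (2 l)! cosh / sinh^(2 l + 1) +
    (2 l + 2)! cosh / sinh^(2 l + 3)]. Hence the coefficients of the even derivatives of [coth] obey
    this recurrence; here the binomial sums are shown to obey it. *)
Lemma coth_coef_rec (k l : nat) :
  coth_coef (S k) (S l) = 4 * INR (S l) ^ 2 * coth_coef k (S l) + coth_coef k l.
Proof.
  (* The last term is what is left over from [S_ext_rec] by summing up to [N]
     only. *)
  assert (H : forall N,
    (sum_n (fun j => coth_weight (S k) (S l) j * S_ext j (S l)) N : R) =
    4 * INR (S l) ^ 2 * sum_n (fun j => coth_weight k (S l) j * S_ext j (S l)) N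
    + sum_n (fun j => coth_weight k l j * S_ext j l) N
    - coth_weight k l N * S_ext (S N) (S l)).
  { induction N as [|N IH].
    - rewrite !sum_O_R, S_ext_rec, (S_ext_gt 0 (S l)) by lia. ring.
    - rewrite !sum_Sn_R, IH.
      rewrite coth_weight_succ. rewrite (S_ext_rec (S N) l). rewrite (S_ext_rec N l).
      unfold coth_weight.
      replace (2 * S N + 1)%nat with (2 * N + 3)%nat by lia.
      replace (2 * S N)%nat with (2 * N + 2)%nat by lia.
      rewrite !plus_INR, !mult_INR, S_INR. simpl (INR 2). simpl (INR 1). ring. }
  rewrite !(coth_coef_extend k). unfold coth_coef. rewrite H.
  (* At [N = S k] the leftover weight contains only binomials of lower index at least [2 k + 2],
     which vanish. *)
  unfold coth_weight at 3. rewrite !(binom_gt (2 * k)) by lia. ring.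
Qed.

(** This is the alternating sum of row [2 k + 2] of binomials; truncated after the index [2 N + 1],
    it equals [- binom (2 k + 1) (2 N + 1)], expanded below by Pascal's rule. It removes
    [cosh / sinh] from the even derivatives of positive order. *)
Lemma coth_coef_succ_0 (k : nat) : coth_coef (S k) 0 = 0.
Proof.
  assert (H : forall N,
    (sum_n (fun j => coth_weight (S k) 0 j * S_ext j 0) N : R) =
    - (binom (2 * k) (2 * N) + binom (2 * k) (2 * N + 1))).
  { induction N as [|N IH].
    - rewrite sum_O_R, S_ext_0_r. unfold coth_weight.
      replace (2 * S k)%nat with (S (S (2 * k))) by lia. simpl (2 * 0 + 1)%nat.
      rewrite !binom_pascal. simpl (2 * 0)%nat. rewrite !binom_0_r. simpl. ring.
    - rewrite sum_Sn_R, IH, S_ext_0_r, coth_weight_succ.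
      replace (2 * S N + 1)%nat with (2 * N + 3)%nat by lia.
      replace (2 * S N)%nat with (2 * N + 2)%nat by lia.
      simpl (2 * 0 + 1)%nat. simpl (INR 1). ring. }
  unfold coth_coef. rewrite H, !(binom_gt (2 * k)) by lia. ring.
Qed.

Lemma coth_coef_0_0 : coth_coef 0 0 = 1.
Proof.
  unfold coth_coef, coth_weight. rewrite sum_O_R, S_ext_0_r, (binom_gt _ (2 * 0 + 1)) by lia.
  simpl (2 * 0)%nat. rewrite binom_0_r. ring.
Qed.

Lemma coth_coef_gt (k l : nat) : (k < l)%nat -> coth_coef k l = 0.
Proof.
  intros H. unfold coth_coef.
  rewrite (sum_n_ext_loc _ (fun _ => zero)).
  - exact (sum_n_m_const_zero (G := R_AbelianMonoid) 0 k).
  - intros j Hj. rewrite S_ext_gt by lia. apply Rmult_0_r.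
Qed.

(** Interchange over the triangle [s <= l <= j <= k], used with [s = 1] for the even exponent and
    [s = 0] for the odd one. *)
Lemma sum_n_m_triangle {G : AbelianMonoid} (F : nat -> nat -> G) (s k : nat) :
  sum_n_m (fun j => sum_n_m (F j) s j) s k =
  sum_n_m (fun l => sum_n_m (fun j => F j l) l k) s k.
Proof.
  destruct (le_lt_dec s k) as [Hs|Hs];
    [| now rewrite !sum_n_m_zero by lia].
  induction k as [|k IH].
  - replace s with 0%nat by lia. now rewrite !sum_n_n.
  - destruct (Nat.eq_dec s (S k)) as [->|Hk]; [now rewrite !sum_n_n|].
    rewrite sum_n_Sm, IH by lia.
    rewrite (sum_n_m_ext_loc (fun l => sum_n_m (fun j => F j l) l (S k))
      (fun l => plus (sum_n_m (fun j => F j l) l k) (F (S k) l))).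
    2:{ intros l Hl. rewrite sum_n_Sm by lia. reflexivity. }
    rewrite sum_n_m_plus. f_equal.
    rewrite (sum_n_Sm (fun l => sum_n_m (fun j => F j l) l k)) by lia.
    rewrite (sum_n_m_zero _ (S k) k) by lia. now rewrite plus_zero_r.
Qed.

(** [S_ext] vanishes for [j < l] and agrees with [Sjl] from [j = l] on, which is the range occurring
    in the theorem. *)
Lemma coth_coef_trunc (k l : nat) :
  (l <= k)%nat ->
  sum_n_m (fun j => coth_weight k l j * Sjl j l) l k = coth_coef k l.
Proof.
  intros H. unfold coth_coef, sum_n. destruct l as [|l].
  - apply sum_n_m_ext_loc. intros j Hj. now rewrite S_ext_le by lia.
  - rewrite (sum_n_m_Chasles _ 0 l k) by lia.
    rewrite (sum_n_m_ext_loc _ (fun _ => zero) 0 l), sum_n_m_const_zero, plus_zero_l.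
    + apply sum_n_m_ext_loc. intros j Hj. now rewrite S_ext_le by lia.
    + intros j Hj. rewrite S_ext_gt by lia. apply Rmult_0_r.
Qed.

(** * Derivatives of coth *)

Lemma sinh_pos (x : R) : 0 < x -> 0 < sinh x.
Proof. intros H. rewrite <- sinh_0. now apply sinh_lt. Qed.

Lemma cosh_sqr (x : R) : cosh x ^ 2 = 1 + sinh x ^ 2.
Proof.
  unfold cosh, sinh. assert (H : exp x * exp (- x) = 1).
  { rewrite <- exp_plus, Rplus_opp_r. apply exp_0. }
  nra.
Qed.

(* The derivative of order [2 k] of [coth]. *)
Definition coth_even (k : nat) (x : R) : R :=
  sum_n (fun l => INR (fact (2 * l)) * coth_coef k l
                  * (cosh x / sinh x ^ (2 * l + 1))) k.

(* Minus the derivative of order [2 k + 1] of [coth]. *)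
Definition coth_odd (k : nat) (x : R) : R :=
  sum_n (fun l => INR (fact (2 * l + 1)) * coth_coef (S k) (S l)
                  * / sinh x ^ (2 * l + 2)) k.

Lemma INR_fact_S (n : nat) : INR (fact (S n)) = INR (S n) * INR (fact n).
Proof. rewrite fact_simpl. apply mult_INR. Qed.

Lemma sum_n_scal_R (c : R) (u : nat -> R) (n : nat) :
  (sum_n (fun i => c * u i) n : R) = c * sum_n u n.
Proof. exact (sum_n_m_mult_l (K := R_Ring) c u 0 n). Qed.

Lemma sum_n_head_R (u : nat -> R) (n : nat) :
  (sum_n u (S n) : R) = u 0%nat + sum_n (fun i => u (S i)) n.
Proof.
  induction n as [|n IH].
  - now rewrite sum_Sn_R, !sum_O_R.
  - rewrite sum_Sn_R, IH, (sum_Sn_R (fun i => u (S i))). ring.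
Qed.

(** The derivative of the term of index [l] is minus the term of index [l + 1] of [coth_even (S k)],
    the exponent [2 l + 2] completing the factorial. The term of index 0 of [coth_even (S k)] is
    zero by [coth_coef_succ_0]. *)
Lemma is_derive_coth_odd (k : nat) (x : R) :
  0 < x -> is_derive (coth_odd k) x (- coth_even (S k) x).
Proof.
  intros Hx. assert (Hs := sinh_pos x Hx).
  unfold coth_even. rewrite sum_n_head_R, coth_coef_succ_0.
  rewrite <- (Rmult_1_l (sum_n _ k)), Rmult_0_r, Rmult_0_l, Rplus_0_l,
    Ropp_mult_distr_l, <- sum_n_scal_R.
  apply (is_derive_sum_n (fun l x => INR (fact (2 * l + 1)) * coth_coef (S k) (S l)
                  * / sinh x ^ (2 * l + 2))).
  intros l _.
  assert (H0 : sinh x ^ (2 * l) <> 0) by (apply pow_nonzero; lra).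
  auto_derive.
  - apply pow_nonzero; lra.
  - change (l + (l + 0))%nat with (2 * l)%nat.
    replace (2 * S l)%nat with (S (2 * l + 1)) by lia.
    rewrite INR_fact_S.
    replace (pred (2 * l + 2)) with (2 * l + 1)%nat by lia.
    replace (2 * l + 2)%nat with (S (2 * l + 1)) by lia.
    replace (S (2 * l + 1) + 1)%nat with (S (S (2 * l + 1))) by lia.
    replace (2 * l + 1)%nat with (S (2 * l)) by lia.
    rewrite <- !tech_pow_Rmult. field. repeat split; first [assumption | lra | apply pow_nonzero; lra].
Qed.

(** After [cosh^2 = 1 + sinh^2], each term contributes to the two consecutive powers [sinh^(- 2 l)]
    and [sinh^(- 2 l - 2)]; [coth_coef_rec] collects the contributions. *)
Lemma is_derive_coth_even (k : nat) (x : R) :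
  0 < x -> is_derive (coth_even k) x (- coth_odd k x).
Proof.
  intros Hx. assert (Hs := sinh_pos x Hx).
  set (d := fun l => - (INR (fact (2 * l)) * coth_coef k l)
    * (INR (2 * l) * / sinh x ^ (2 * l) + INR (2 * l + 1) * / sinh x ^ (2 * l + 2))).
  (* The sum up to [N] lacks the contribution of [d (S N)] to [sinh^(- 2 N - 2)]; the last summand
     corrects for this and vanishes at [N = k]. *)
  assert (E : forall N, (sum_n d N : R) =
    - sum_n (fun l => INR (fact (2 * l + 1)) * coth_coef (S k) (S l)
                  * / sinh x ^ (2 * l + 2)) N
    + INR (fact (2 * N + 2)) * INR (2 * N + 2) * coth_coef k (S N)
      * / sinh x ^ (2 * N + 2)).
  { assert (F1 : forall l, INR (fact (2 * l + 1)) = INR (2 * l + 1) * INR (fact (2 * l))).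
    { intros l. replace (2 * l + 1)%nat with (S (2 * l)) by lia. apply INR_fact_S. }
    assert (F2 : forall l, INR (fact (2 * l + 2)) = INR (2 * l + 2) * INR (fact (2 * l + 1))).
    { intros l. replace (2 * l + 2)%nat with (S (2 * l + 1)) by lia. apply INR_fact_S. }
    induction N as [|N IH].
    - rewrite !sum_O_R. unfold d. rewrite coth_coef_rec. simpl. field. lra.
    - rewrite !sum_Sn_R, IH. unfold d. rewrite (coth_coef_rec k (S N)).
      rewrite (F2 (S N)), (F1 (S N)).
      replace (2 * S N)%nat with (2 * N + 2)%nat by lia.
      rewrite (S_INR (S N)), (S_INR N).
      rewrite !plus_INR, !mult_INR. simpl (INR 2). simpl (INR 1). ring. }
  replace (- coth_odd k x) with (sum_n d k : R).
  - apply (is_derive_sum_n (fun l x => INR (fact (2 * l)) * coth_coef k l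
                  * (cosh x / sinh x ^ (2 * l + 1)))).
    intros l _.
    assert (H0 : sinh x ^ (2 * l) <> 0) by (apply pow_nonzero; lra).
    auto_derive.
    + apply pow_nonzero; lra.
    + unfold d. change (l + (l + 0))%nat with (2 * l)%nat.
      replace (pred (2 * l + 1)) with (2 * l)%nat by lia.
      replace (2 * l + 2)%nat with (S (S (2 * l))) by lia.
      replace (2 * l + 1)%nat with (S (2 * l)) by lia.
      rewrite <- !tech_pow_Rmult, S_INR.
      transitivity (INR (fact (2 * l)) * coth_coef k l *
        (/ sinh x ^ (2 * l) - (INR (2 * l) + 1) * cosh x ^ 2 / (sinh x ^ 2 * sinh x ^ (2 * l)))).
      * field. repeat split; first [assumption | lra | apply pow_nonzero; lra].
      * rewrite cosh_sqr. field. repeat split; first [assumption | lra | apply pow_nonzero; lra].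
  - rewrite E, (coth_coef_gt k (S k)) by lia. unfold coth_odd. ring.
Qed.

(** * Product formula for sinh *)

Definition cosh_cos_int (c : R) (n : nat) : R :=
  RInt (fun t => cosh (c * t) * cos t ^ n) 0 (PI / 2).

Lemma cosh_cos_continuous (c t : R) (n : nat) :
  continuous (fun t => cosh (c * t) * cos t ^ n) t.
Proof. apply (ex_derive_continuous (V := R_NormedModule)). auto_derive. easy. Qed.

Lemma ex_RInt_cosh_cos (c : R) (n : nat) :
  ex_RInt (fun t => cosh (c * t) * cos t ^ n) 0 (PI / 2).
Proof.
  apply (ex_RInt_continuous (V := R_CompleteNormedModule)). intros t _. apply cosh_cos_continuous.
Qed.

(** Two integrations by parts, done at once by a primitive that vanishes at both ends of the
    interval. *)
Lemma cosh_cos_int_rec (c : R) (n : nat) :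
  (c ^ 2 + INR (n + 2) ^ 2) * cosh_cos_int c (n + 2) =
  INR (n + 2) * INR (n + 1) * cosh_cos_int c n.
Proof.
  assert (H : is_RInt
    (fun t => (c ^ 2 + INR (n + 2) ^ 2) * (cosh (c * t) * cos t ^ (n + 2))
              + - (INR (n + 2) * INR (n + 1)) * (cosh (c * t) * cos t ^ n))
    0 (PI / 2) 0).
  (* In the derivative of [f] the terms with [sinh] cancel, and [sin^2 = 1 - cos^2] leaves the
     integrand. *)
  { set (f := fun t => c * sinh (c * t) * cos t ^ (n + 2)
        + INR (n + 2) * cosh (c * t) * cos t ^ (n + 1) * sin t).
    evar_last.
    - apply (is_RInt_derive (V := R_CompleteNormedModule) f).
      + intros t _. unfold f. auto_derive; [easy|].
        replace (pred (n + 2)) with (n + 1)%nat by lia.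
        replace (pred (n + 1)) with n by lia.
        replace (n + 2)%nat with (S (n + 1)) by lia.
        rewrite !(S_INR (n + 1)).
        replace (n + 1)%nat with (S n) by lia.
        rewrite <- !tech_pow_Rmult.
        assert (E : sin t ^ 2 = 1 - cos t ^ 2).
        { rewrite <- !Rsqr_pow2. apply sin2. }
        ring_simplify. rewrite E. ring.
      + intros t _. apply (ex_derive_continuous (V := R_NormedModule)).
        auto_derive. easy.
    - unfold f, minus, plus, opp; simpl.
      rewrite cos_PI2, sin_0, Rmult_0_r, sinh_0.
      rewrite !pow_i by lia. ring. }
  assert (H' := is_RInt_plus _ _ _ _ _ _
    (is_RInt_scal _ _ _ (c ^ 2 + INR (n + 2) ^ 2) _
       (RInt_correct (V := R_CompleteNormedModule) _ _ _ (ex_RInt_cosh_cos c (n + 2))))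
    (is_RInt_scal _ _ _ (- (INR (n + 2) * INR (n + 1))) _
       (RInt_correct (V := R_CompleteNormedModule) _ _ _ (ex_RInt_cosh_cos c n)))).
  apply (is_RInt_unique (V := R_CompleteNormedModule)) in H, H'.
  assert (E := eq_trans (eq_sym H') H).
  unfold plus, scal in E; simpl in E. unfold mult in E; simpl in E.
  unfold cosh_cos_int. lra.
Qed.

Lemma cosh_0_int_pos (n : nat) : 0 < cosh_cos_int 0 n.
Proof.
  apply RInt_gt_0; [generalize PI_RGT_0; lra | |].
  - intros t Ht. rewrite Rmult_0_l, cosh_0. apply Rmult_lt_0_compat; [lra|].
    apply pow_lt, cos_gt_0; lra.
  - intros t _. apply cosh_cos_continuous.
Qed.

Lemma exp_le (x y : R) : x <= y -> exp x <= exp y.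
Proof. intros [H| ->]; [left; now apply exp_increasing | right; reflexivity]. Qed.

Lemma cosh_ge_1 (x : R) : 1 <= cosh x.
Proof.
  assert (H := cosh_sqr x). assert (0 < cosh x).
  { unfold cosh. assert (H1 := exp_pos x). assert (H2 := exp_pos (- x)). lra. }
  nra.
Qed.

(** Since [t <= 2], the lower Taylor bound [t - t^3/6 + t^5/120 - t^7/5040] is at least
    [t - 4 t / 6]. *)
Lemma sin_ge_third (t : R) : 0 <= t <= PI / 2 -> t / 3 <= sin t.
Proof.
  intros [H0 H1]. assert (H4 := PI_4).
  destruct (SIN t) as [H _]; [lra | lra |].
  eapply Rle_trans; [|exact H].
  unfold sin_lb, sin_approx, sin_term. simpl.
  assert (T : t <= 2) by lra. assert (T2 : t * t <= 4) by nra.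
  assert (T4 : 0 <= t * (t * t) * (t * t)).
  { repeat apply Rmult_le_pos; lra. }
  assert (T3 : 0 <= t * (4 - t * t)) by (apply Rmult_le_pos; lra).
  assert (T5 : 0 <= t * (t * t) * (t * t) * (4 - t * t)).
  { apply Rmult_le_pos; lra. }
  field_simplify. nra.
Qed.

(** On the interval, [1 <= cosh (c t) <= 1 + K sin^2 t]. Integrated against [cos^n t], this bounds
    the excess of [I_n(c)] over [I_n(0)] by [K (I_n(0) - I_(n+2)(0))], which is [K I_n(0) / (n + 2)]
    by the recurrence at [c = 0]. *)
Lemma cosh_cos_int_ratio_bounds (c : R) :
  exists K, 0 <= K /\ forall n,
    1 <= cosh_cos_int c n / cosh_cos_int 0 n <= 1 + K / INR (n + 2).
Proof.
  assert (HK : exists K, 0 <= K /\ forall t, 0 <= t <= PI / 2 ->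
    cosh (c * t) <= 1 + K * (1 - cos t ^ 2)).
  (* With [y = c t], the constant combines [cosh y - 1 = 2 sinh^2 (y / 2)], the mean value bound
     [|sinh (y / 2)| <= M |y / 2|], and [t <= 3 sin t]. *)
  { set (M := exp (2 * Rabs c)). exists (9 / 2 * (M * c) ^ 2).
    split; [generalize (pow2_ge_0 (M * c)); lra|]. intros t Ht.
    assert (H4 := PI_4).
    assert (Hc : cosh (c * t) = 1 + 2 * sinh (c * t / 2) ^ 2).
    { assert (E := cosh_sqr (c * t / 2)).
      unfold cosh, sinh in *.
      replace (c * t) with (c * t / 2 + c * t / 2) at 1 2 by field.
      rewrite Ropp_plus_distr, !exp_plus. nra. }
    assert (Hs : sinh (c * t / 2) ^ 2 <= (M * (c * t / 2)) ^ 2).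
    { destruct (MVT_gen sinh 0 (c * t / 2) cosh) as [xi [Hxi E]].
      - intros; auto_derive; [easy | ring].
      - intros y _. apply continuity_pt_filterlim.
        apply (ex_derive_continuous (V := R_NormedModule) sinh). auto_derive. easy.
      - rewrite sinh_0, !Rminus_0_r in E. rewrite E, !Rpow_mult_distr.
        apply Rmult_le_compat_r; [apply pow2_ge_0|].
        assert (H1 := cosh_ge_1 xi). apply pow_incr. split; [lra|].
        assert (X : Rabs xi <= 2 * Rabs c).
        { assert (A : Rabs (c * t / 2) <= Rabs c).
          { unfold Rdiv. rewrite Rmult_assoc, Rabs_mult.
            rewrite <- (Rmult_1_r (Rabs c)) at 2.
            apply Rmult_le_compat_l; [apply Rabs_pos|].
            rewrite Rabs_right; lra. }
          assert (A0 := Rabs_pos c). revert A Hxi.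
          unfold Rmin, Rmax, Rabs.
          destruct (Rle_dec 0 (c * t / 2)), (Rcase_abs (c * t / 2)),
            (Rcase_abs xi), (Rcase_abs c); lra. }
        unfold cosh, M.
        assert (X1 : exp xi <= exp (2 * Rabs c)).
        { apply exp_le. generalize (Rle_abs xi). lra. }
        assert (X2 : exp (- xi) <= exp (2 * Rabs c)).
        { apply exp_le. generalize (Rle_abs (- xi)). rewrite Rabs_Ropp. lra. }
        lra. }
    assert (Ht3 := sin_ge_third t Ht).
    assert (E : 1 - cos t ^ 2 = sin t ^ 2).
    { rewrite <- !Rsqr_pow2, sin2. reflexivity. }
    assert (Ht2 : t ^ 2 <= 9 * sin t ^ 2) by nra.
    rewrite Hc, E.
    replace (M * (c * t / 2)) with (M * c * t / 2) in Hs by field.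
    assert (P := pow2_ge_0 (M * c)). nra. }
  destruct HK as [K [HK0 HK]]. exists K. split; [exact HK0|]. intros n.
  assert (P := cosh_0_int_pos n). assert (PP := PI_RGT_0).
  assert (L : cosh_cos_int 0 n <= cosh_cos_int c n).
  { apply RInt_le; try apply ex_RInt_cosh_cos; [lra|].
    intros t Ht. apply Rmult_le_compat_r.
    - apply pow_le, cos_ge_0; lra.
    - rewrite Rmult_0_l, cosh_0. apply cosh_ge_1. }
  assert (U : cosh_cos_int c n <= (1 + K) * cosh_cos_int 0 n - K * cosh_cos_int 0 (n + 2)).
  { set (f := fun t => (1 + K) * (cosh (0 * t) * cos t ^ n)
                       + - K * (cosh (0 * t) * cos t ^ (n + 2))).
    assert (H' : is_RInt f 0 (PI / 2)
      ((1 + K) * cosh_cos_int 0 n + - K * cosh_cos_int 0 (n + 2))).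
    { exact (is_RInt_plus (V := R_NormedModule) _ _ _ _ _ _
        (is_RInt_scal _ _ _ (1 + K) _
          (RInt_correct (V := R_CompleteNormedModule) _ _ _ (ex_RInt_cosh_cos 0 n)))
        (is_RInt_scal _ _ _ (- K) _
          (RInt_correct (V := R_CompleteNormedModule) _ _ _
             (ex_RInt_cosh_cos 0 (n + 2))))). }
    replace ((1 + K) * cosh_cos_int 0 n - K * cosh_cos_int 0 (n + 2))
      with (RInt f 0 (PI / 2) : R).
    2:{ rewrite (is_RInt_unique (V := R_CompleteNormedModule) _ _ _ _ H'). ring. }
    apply RInt_le; [lra | apply ex_RInt_cosh_cos | eexists; exact H' |].
    intros t Ht. unfold f.
    rewrite Rmult_0_l, cosh_0, pow_add.
    assert (C0 : 0 <= cos t ^ n) by (apply pow_le, cos_ge_0; lra).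
    assert (HKt := HK t). nra. }
  assert (E := cosh_cos_int_rec 0 n).
  assert (N : 0 < INR (n + 2)) by (apply lt_0_INR; lia).
  assert (E1 : INR (n + 1) = INR (n + 2) - 1).
  { replace (n + 2)%nat with (S (n + 1)) by lia. rewrite S_INR. ring. }
  assert (E2 : cosh_cos_int 0 (n + 2) = cosh_cos_int 0 n - cosh_cos_int 0 n / INR (n + 2)).
  { apply Rmult_eq_reg_l with (INR (n + 2) ^ 2); [|apply pow_nonzero; lra].
    replace (INR (n + 2) ^ 2 * cosh_cos_int 0 (n + 2)) with
      ((0 ^ 2 + INR (n + 2) ^ 2) * cosh_cos_int 0 (n + 2)) by ring.
    rewrite E, E1. field. lra. }
  split.
  - apply Rmult_le_reg_r with (cosh_cos_int 0 n); [exact P|].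
    unfold Rdiv. rewrite Rmult_assoc, Rinv_l by lra. lra.
  - apply Rmult_le_reg_r with (cosh_cos_int 0 n); [exact P|].
    unfold Rdiv. rewrite Rmult_assoc, Rinv_l by lra.
    rewrite E2 in U. unfold Rdiv in U. lra.
Qed.

Definition cosh_cos_ratio (c : R) (N : nat) : R :=
  cosh_cos_int c (2 * N) / cosh_cos_int 0 (2 * N).

Lemma cosh_cos_ratio_0 (c : R) :
  0 < c -> cosh_cos_ratio c 0 = sinh (c * (PI / 2)) / (c * (PI / 2)).
Proof.
  intros Hc. assert (HP := PI_RGT_0).
  unfold cosh_cos_ratio, cosh_cos_int.
  replace (RInt (fun t => cosh (c * t) * cos t ^ (2 * 0)) 0 (PI / 2) : R)
    with (sinh (c * (PI / 2)) / c).
  replace (RInt (fun t => cosh (0 * t) * cos t ^ (2 * 0)) 0 (PI / 2) : R)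
    with (PI / 2).
  - field. lra.
  - symmetry. apply is_RInt_unique. evar_last.
    + apply (is_RInt_derive (V := R_CompleteNormedModule) (fun t => t)).
      * intros t _. auto_derive; [easy|]. rewrite Rmult_0_l, cosh_0. simpl. ring.
      * intros t _. apply cosh_cos_continuous.
    + unfold minus, plus, opp; simpl. ring.
  - symmetry. apply is_RInt_unique. evar_last.
    + apply (is_RInt_derive (V := R_CompleteNormedModule) (fun t => sinh (c * t) / c)).
      * intros t _. auto_derive; [lra|]. simpl. field. lra.
      * intros t _. apply cosh_cos_continuous.
    + unfold minus, plus, opp; simpl. rewrite Rmult_0_r, sinh_0. field. lra.
Qed.

(** Dividing the recurrence at [c] by the one at 0 cancels [(n + 2) (n + 1)]. For [c = 2 x / PI] the
    remaining factor is [1 + (x / (PI (N + 1)))^2], a factor of the product for [sinh x / x]. *)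
Lemma cosh_cos_ratio_rec (c : R) (N : nat) :
  cosh_cos_ratio c N = (1 + (c / (2 * INR (S N))) ^ 2) * cosh_cos_ratio c (S N).
Proof.
  unfold cosh_cos_ratio.
  replace (2 * S N)%nat with (2 * N + 2)%nat by lia.
  assert (E := cosh_cos_int_rec c (2 * N)).
  assert (E0 := cosh_cos_int_rec 0 (2 * N)).
  assert (P := cosh_0_int_pos (2 * N)).
  assert (P2 := cosh_0_int_pos (2 * N + 2)).
  assert (H1 : 0 < INR (2 * N + 1)) by (apply lt_0_INR; lia).
  assert (H2 : INR (2 * N + 2) = 2 * INR (S N)).
  { replace (2 * N + 2)%nat with (2 * S N)%nat by lia. now rewrite mult_INR. }
  assert (H3 : 0 < INR (S N)) by (apply lt_0_INR; lia).
  rewrite H2 in E, E0.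
  replace (cosh_cos_int c (2 * N)) with
    ((c ^ 2 + (2 * INR (S N)) ^ 2) * cosh_cos_int c (2 * N + 2)
     / (2 * INR (S N) * INR (2 * N + 1))) by (rewrite E; field; lra).
  replace (cosh_cos_int 0 (2 * N)) with
    ((0 ^ 2 + (2 * INR (S N)) ^ 2) * cosh_cos_int 0 (2 * N + 2)
     / (2 * INR (S N) * INR (2 * N + 1))) by (rewrite E0; field; lra).
  field. repeat split; lra.
Qed.

Lemma is_lim_seq_inv_INR_S : is_lim_seq (fun n => / INR (S n)) 0.
Proof.
  replace (Finite 0) with (Rbar_inv p_infty) by reflexivity.
  apply is_lim_seq_inv; [|discriminate].
  apply -> (is_lim_seq_incr_1 INR). apply is_lim_seq_INR.
Qed.

Lemma is_lim_seq_cosh_cos_ratio (c : R) : is_lim_seq (cosh_cos_ratio c) 1.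
Proof.
  destruct (cosh_cos_int_ratio_bounds c) as [K [HK0 HK]].
  apply is_lim_seq_le_le with (fun _ => 1) (fun n => 1 + K * / INR (S n)).
  - intros n. destruct (HK (2 * n)%nat) as [H1 H2]. split; [exact H1|].
    eapply Rle_trans; [exact H2|]. apply Rplus_le_compat_l.
    apply Rmult_le_compat_l; [exact HK0|].
    apply Rinv_le_contravar; [apply lt_0_INR; lia | apply le_INR; lia].
  - apply is_lim_seq_const.
  - replace (Finite 1) with (Finite (1 + K * 0)) by (f_equal; ring).
    apply is_lim_seq_plus'; [apply is_lim_seq_const|].
    apply (is_lim_seq_scal_l _ K 0), is_lim_seq_inv_INR_S.
Qed.

(** The logarithms telescope along [cosh_cos_ratio_rec], from [ln (sinh x / x)] at [N = 0] towards
    [ln 1]. *)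
Lemma is_series_ln_sinh (x : R) :
  0 < x ->
  is_series (fun n => ln (1 + (x / (PI * INR (S n))) ^ 2)) (ln (sinh x / x)).
Proof.
  intros Hx. assert (HP := PI_RGT_0).
  set (c := 2 * x / PI).
  assert (Hc : 0 < c) by (apply Rdiv_lt_0_compat; lra).
  assert (Hpos : forall N, 0 < cosh_cos_ratio c N).
  { intros N. destruct (cosh_cos_int_ratio_bounds c) as [K [_ HK]].
    destruct (HK (2 * N)%nat) as [H _]. unfold cosh_cos_ratio. lra. }
  assert (E0 : sinh x / x = cosh_cos_ratio c 0).
  { rewrite cosh_cos_ratio_0 by exact Hc.
    replace (c * (PI / 2)) with x by (unfold c; field; lra). reflexivity. }
  assert (E : forall N,
    (sum_n (fun n => ln (1 + (x / (PI * INR (S n))) ^ 2)) N : R)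
    = ln (sinh x / x) - ln (cosh_cos_ratio c (S N))).
  { assert (step : forall N, ln (1 + (x / (PI * INR (S N))) ^ 2)
        = ln (cosh_cos_ratio c N) - ln (cosh_cos_ratio c (S N))).
    { intros N. rewrite (cosh_cos_ratio_rec c N).
      replace (c / (2 * INR (S N))) with (x / (PI * INR (S N))).
      2:{ unfold c. field. split; [lra | apply not_0_INR; lia]. }
      rewrite ln_mult; [ring | | apply Hpos].
      generalize (pow2_ge_0 (x / (PI * INR (S N)))). lra. }
    induction N as [|N IH].
    - rewrite sum_O_R, step, E0. reflexivity.
    - rewrite sum_Sn_R, IH, step. ring. }
  change (is_lim_seq (sum_n (fun n => ln (1 + (x / (PI * INR (S n))) ^ 2)))
            (ln (sinh x / x))).
  apply is_lim_seq_ext with (fun N => ln (sinh x / x) - ln (cosh_cos_ratio c (S N))).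
  { intros N. symmetry. apply E. }
  replace (Finite (ln (sinh x / x))) with (Finite (ln (sinh x / x) - ln 1))
    by (rewrite ln_1; f_equal; ring).
  apply is_lim_seq_minus'; [apply is_lim_seq_const|].
  apply (is_lim_seq_continuous ln (fun N => cosh_cos_ratio c (S N)) 1).
  - apply derivable_continuous_pt. exists (/ 1). apply derivable_pt_lim_ln. lra.
  - apply (is_lim_seq_incr_1 (cosh_cos_ratio c)), is_lim_seq_cosh_cos_ratio.
Qed.

(** * Partial fractions of coth and its derivatives *)

(** Comparison with a telescoping series, by [1 / n^2 <= 2 / (n (n + 1))]. *)
Lemma ex_series_inv_sqr : ex_series (fun n => / INR (S n) ^ 2).
Proof.
  apply (ex_series_le (V := R_CompleteNormedModule) _
           (fun n => 2 * (/ INR (S n) - / INR (S (S n))))).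
  - intros n. change norm with Rabs.
    assert (H := pos_INR n). rewrite Rabs_right.
    + rewrite !S_INR.
      apply Rminus_le_0.
      replace (2 * (/ (INR n + 1) - / (INR n + 1 + 1)) - / (INR n + 1) ^ 2)
        with (INR n / ((INR n + 1) ^ 2 * (INR n + 1 + 1))) by (field; lra).
      apply Rdiv_le_0_compat; [exact H|].
      apply Rmult_lt_0_compat; [apply pow_lt|]; lra.
    + apply Rle_ge, Rlt_le, Rinv_0_lt_compat, pow_lt, lt_0_INR. lia.
  - apply (ex_series_scal 2 (fun n => / INR (S n) - / INR (S (S n)))).
    exists 1.
    change (is_lim_seq (sum_n (fun n => / INR (S n) - / INR (S (S n)))) 1).
    apply is_lim_seq_ext with (fun n => 1 - / INR (S (S n))).
    + induction n as [|n IH].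
      * rewrite sum_O_R. simpl. field.
      * rewrite sum_Sn_R, <- IH. ring.
    + replace (Finite 1) with (Finite (1 - 0)) by (f_equal; ring).
      apply is_lim_seq_minus'; [apply is_lim_seq_const|].
      apply (is_lim_seq_incr_1 (fun n => / INR (S n))), is_lim_seq_inv_INR_S.
Qed.

Lemma is_series_abs_le (a b : nat -> R) (la lb : R) :
  is_series a la -> is_series b lb -> (forall n, Rabs (a n) <= b n) ->
  Rabs la <= lb.
Proof.
  intros Ha Hb H.
  assert (E : ex_series (fun n => Rabs (a n))).
  { apply (ex_series_le (V := R_CompleteNormedModule) _ b); [|now exists lb].
    intros n. change norm with Rabs. rewrite Rabs_Rabsolu. apply H. }
  rewrite <- (is_series_unique _ _ Ha), <- (is_series_unique _ _ Hb).
  eapply Rle_trans; [now apply Series_Rabs|].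
  apply Series_le; [|now exists lb]. intros n. split; [apply Rabs_pos | apply H].
Qed.

(** The mean value theorem is applied to [f] and then to [f1]. This loses the factor [1/2] of
    Taylor's formula, but an error of order [h^2] is all that differentiation requires. *)
Lemma taylor1_bound (f f1 f2 : R -> R) (B x h : R) :
  (forall t, is_derive f t (f1 t)) -> (forall t, is_derive f1 t (f2 t)) ->
  (forall t, Rabs (f2 t) <= B) ->
  Rabs (f (x + h) - f x - h * f1 x) <= h ^ 2 * B.
Proof.
  intros Hf Hf1 HB.
  assert (D : forall g g1 : R -> R, (forall t, is_derive g t (g1 t)) ->
    forall t, continuity_pt g t).
  { intros g g1 Hg t. apply continuity_pt_filterlim.
    apply (ex_derive_continuous (V := R_NormedModule) g). now exists (g1 t). }
  destruct (MVT_gen f x (x + h) f1) as [xi [Hxi E]];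
    [intros; apply Hf | intros; now apply (D f f1) |].
  destruct (MVT_gen f1 x xi f2) as [eta [Heta E1]];
    [intros; apply Hf1 | intros; now apply (D f1 f2) |].
  rewrite E. replace (f1 xi * (x + h - x) - h * f1 x) with (h * (f1 xi - f1 x)) by ring.
  rewrite E1, !Rabs_mult.
  assert (X : Rabs (xi - x) <= Rabs h).
  { revert Hxi. unfold Rmin, Rmax, Rabs.
    destruct (Rle_dec x (x + h)), (Rcase_abs (xi - x)), (Rcase_abs h); lra. }
  rewrite <- (pow2_abs h).
  assert (P1 := Rabs_pos h). assert (P2 := Rabs_pos (xi - x)).
  assert (P3 := Rabs_pos (f2 eta)). specialize (HB eta).
  assert (Rabs (f2 eta) * Rabs (xi - x) <= B * Rabs h) by (apply Rmult_le_compat; lra).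
  nra.
Qed.

(* Summing the first-order Taylor estimates of the terms differentiates the series
   without uniform convergence of the series of derivatives. *)
Lemma is_derive_series (f f1 f2 : nat -> R -> R) (B : nat -> R) (F : R -> R) (x l : R) :
  (forall n t, is_derive (f n) t (f1 n t)) ->
  (forall n t, is_derive (f1 n) t (f2 n t)) ->
  (forall n t, Rabs (f2 n t) <= B n) -> ex_series B ->
  locally x (fun t => is_series (fun n => f n t) (F t)) ->
  is_series (fun n => f1 n x) l ->
  is_derive F x l.
Proof.
  intros Hf Hf1 HB [b Hb] [d Hd] Hl.
  assert (Hb0 : 0 <= b).
  { assert (X := is_series_abs_le _ _ _ _ (is_series_scal 0 _ _ Hb) Hb).
    eapply Rle_trans; [|apply X]; [apply Rabs_pos|].
    intros n. unfold scal; simpl; unfold mult; simpl.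
    rewrite Rmult_0_l, Rabs_R0. eapply Rle_trans; [apply Rabs_pos | apply (HB n 0)]. }
  apply is_derive_Reals. intros eps Heps.
  (* The first bound keeps [x + h] where the series is known to converge; the second gives
     [|h| b < eps], with [b + 1] because [b] may be 0. *)
  assert (Hm : 0 < Rmin d (eps / (b + 1))).
  { apply Rmin_pos; [apply cond_pos|]. apply Rdiv_lt_0_compat; lra. }
  exists (mkposreal _ Hm). simpl. intros h Hh0 Hh.
  assert (Hhd := Rlt_le_trans _ _ _ Hh (Rmin_l _ _)).
  assert (Hhe := Rlt_le_trans _ _ _ Hh (Rmin_r _ _)).
  assert (S1 : is_series (fun n => f n (x + h)) (F (x + h))).
  { apply Hd. change (Rabs (x + h - x) < d).
    replace (x + h - x) with h by ring. exact Hhd. }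
  assert (S0 : is_series (fun n => f n x) (F x)).
  { apply Hd. apply (ball_center (M := R_UniformSpace)). }
  assert (S2 := is_series_minus _ _ _ _ (is_series_minus _ _ _ _ S1 S0)
                  (is_series_scal h _ _ Hl)).
  assert (X := is_series_abs_le _ _ _ _ S2 (is_series_scal (h ^ 2) _ _ Hb)).
  assert (Y : Rabs (F (x + h) - F x - h * l) <= h ^ 2 * b).
  { apply X. intros n. apply (taylor1_bound (f n) (f1 n) (f2 n)); auto. }
  replace ((F (x + h) - F x) / h - l) with ((F (x + h) - F x - h * l) / h)
    by (field; exact Hh0).
  assert (Ph : 0 < Rabs h) by (now apply Rabs_pos_lt).
  unfold Rdiv. rewrite Rabs_mult, Rabs_inv.
  apply Rmult_lt_reg_r with (Rabs h); [exact Ph|].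
  rewrite Rmult_assoc, Rinv_l, Rmult_1_r by lra.
  eapply Rle_lt_trans; [exact Y|]. rewrite <- (pow2_abs h).
  apply Rmult_lt_compat_r with (r := b + 1) in Hhe; [|lra].
  unfold Rdiv in Hhe. rewrite Rmult_assoc, Rinv_l in Hhe by lra.
  nra.
Qed.

(** The two real arguments are kept apart because the real and imaginary parts are differentiated as
    real functions of [x]. *)
Definition zinv_pow (p : nat) (x y : R) : C := Cpow (/ (x, y))%C p.

Lemma is_derive_zinv_pow (p : nat) (x y : R) :
  y <> 0 ->
  is_derive (fun t => Re (zinv_pow p t y)) x (- INR p * Re (zinv_pow (S p) x y)) /\
  is_derive (fun t => Im (zinv_pow p t y)) x (- INR p * Im (zinv_pow (S p) x y)).
Proof.
  intros Hy.
  assert (Hd : forall t, t ^ 2 + y ^ 2 <> 0).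
  { intros t. assert (0 < y ^ 2) by (now apply pow2_gt_0).
    generalize (pow2_ge_0 t). lra. }
  (* [al + i be] is [1 / (t + i y)], with derivative [- (al + i be)^2]; higher powers follow by the
     product rule. *)
  set (al := fun t => t / (t ^ 2 + y ^ 2)).
  set (be := fun t => - y / (t ^ 2 + y ^ 2)).
  assert (Dal : is_derive al x (- (al x ^ 2 - be x ^ 2))).
  { unfold al, be. auto_derive; [exact (Hd x) | field; exact (Hd x)]. }
  assert (Dbe : is_derive be x (- (2 * al x * be x))).
  { unfold al, be. auto_derive; [exact (Hd x) | field; exact (Hd x)]. }
  assert (Rre : forall q t, Re (zinv_pow (S q) t y) =
    al t * Re (zinv_pow q t y) - be t * Im (zinv_pow q t y)) by reflexivity.
  assert (Rim : forall q t, Im (zinv_pow (S q) t y) =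
    al t * Im (zinv_pow q t y) + be t * Re (zinv_pow q t y)) by reflexivity.
  induction p as [|p [IH1 IH2]].
  - simpl INR. rewrite Ropp_0, !Rmult_0_l.
    split; [exact (is_derive_const (V := R_NormedModule) 1 x)
           | exact (is_derive_const (V := R_NormedModule) 0 x)].
  - split.
    + apply is_derive_ext with
        (fun t => al t * Re (zinv_pow p t y) - be t * Im (zinv_pow p t y));
        [intros t; now rewrite Rre|].
      evar_last.
      * apply (is_derive_minus (V := R_NormedModule)).
        -- apply (is_derive_mult al _ x _ _ Dal IH1). intros; apply Rmult_comm.
        -- apply (is_derive_mult be _ x _ _ Dbe IH2). intros; apply Rmult_comm.
      * rewrite S_INR, (Rre (S p)), (Rre p), (Rim p).
        unfold minus, plus, opp, mult; simpl. ring.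
    + apply is_derive_ext with
        (fun t => al t * Im (zinv_pow p t y) + be t * Re (zinv_pow p t y));
        [intros t; now rewrite Rim|].
      evar_last.
      * apply (is_derive_plus (V := R_NormedModule)).
        -- apply (is_derive_mult al _ x _ _ Dal IH2). intros; apply Rmult_comm.
        -- apply (is_derive_mult be _ x _ _ Dbe IH1). intros; apply Rmult_comm.
      * rewrite S_INR, (Rim (S p)), (Rre p), (Rim p).
        unfold minus, plus, opp, mult; simpl. ring.
Qed.

(** With [N = n + 1], [|x + i PI N| >= PI N >= N >= 1], so any exponent of at least 2 leaves
    [1 / N^2]. The bound is uniform in [x], as [is_derive_series] requires of the second
    derivatives. *)
Lemma Cmod_zinv_pow_le (p n : nat) (x : R) :
  Cmod (zinv_pow (S (S p)) x (PI * INR (S n))) <= / INR (S n) ^ 2.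
Proof.
  assert (HP : 1 <= PI) by (generalize PI2_1; lra).
  assert (Hn : 1 <= INR (S n)) by (rewrite S_INR; generalize (pos_INR n); lra).
  set (y := PI * INR (S n)).
  assert (Hy : INR (S n) <= y).
  { unfold y. rewrite <- (Rmult_1_l (INR (S n))) at 1. apply Rmult_le_compat_r; lra. }
  assert (Hm : INR (S n) <= Cmod (x, y)).
  { eapply Rle_trans; [|apply Rmax_Cmod]. eapply Rle_trans; [|apply Rmax_r].
    cbn [snd]. rewrite Rabs_right; lra. }
  assert (Hz : (x, y) <> RtoC 0).
  { intros E. rewrite E, Cmod_0 in Hm. lra. }
  unfold zinv_pow. rewrite Cmod_pow, Cmod_inv by exact Hz.
  assert (H1 : 0 <= / Cmod (x, y) <= 1).
  { split; [apply Rlt_le, Rinv_0_lt_compat; lra|].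
    rewrite <- Rinv_1. apply Rinv_le_contravar; lra. }
  assert (H2 : / Cmod (x, y) <= / INR (S n)) by (apply Rinv_le_contravar; lra).
  rewrite <- pow_inv. replace (S (S p)) with (2 + p)%nat by lia. rewrite pow_add.
  rewrite <- (Rmult_1_r ((/ INR (S n)) ^ 2)).
  apply Rmult_le_compat; [apply pow_le; lra | apply pow_le; lra | apply pow_incr; lra |].
  rewrite <- (pow1 p). apply pow_incr. lra.
Qed.

Lemma Im_le_Cmod (z : C) : Rabs (Im z) <= Cmod z.
Proof. eapply Rle_trans; [|apply Rmax_Cmod]. apply Rmax_r. Qed.

Lemma ex_series_scal_R (c : R) (u : nat -> R) :
  ex_series u -> ex_series (fun n => c * u n).
Proof. exact (ex_series_scal c u). Qed.

Lemma ex_series_le_R (u v : nat -> R) :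
  (forall n, Rabs (u n) <= v n) -> ex_series v -> ex_series u.
Proof. exact (ex_series_le (V := R_CompleteNormedModule) u v). Qed.

Lemma PI_INR_S_neq_0 (n : nat) : PI * INR (S n) <> 0.
Proof.
  apply Rmult_integral_contrapositive_currified;
    [apply PI_neq0 | apply not_0_INR; lia].
Qed.

(** At exponent [p + 1] the series converges absolutely, to some [L]. Termwise differentiation
    yields [F' = - p L], and comparison with [F' = - p G] identifies [L]. *)
Lemma series_zinv_pow_step (p : nat) (F G : R -> R) :
  (1 <= p)%nat ->
  (forall x, 0 < x -> is_series (fun n => 2 * Re (zinv_pow p x (PI * INR (S n)))) (F x)) ->
  (forall x, 0 < x -> is_derive F x (- INR p * G x)) ->
  forall x, 0 < x ->
    is_series (fun n => 2 * Re (zinv_pow (S p) x (PI * INR (S n)))) (G x).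
Proof.
  intros Hp HF HG x Hx.
  assert (Hp0 : INR p <> 0) by (apply not_0_INR; lia).
  assert (Hex : ex_series (fun n => 2 * Re (zinv_pow (S p) x (PI * INR (S n))))).
  { apply ex_series_scal_R. apply ex_series_le_R with (2 := ex_series_inv_sqr).
    intros n. eapply Rle_trans; [apply re_le_Cmod|].
    destruct p as [|p]; [lia|]. apply Cmod_zinv_pow_le. }
  destruct Hex as [L HL].
  assert (D : is_derive F x (- INR p * L)).
  { apply (is_derive_series
      (fun n t => 2 * Re (zinv_pow p t (PI * INR (S n))))
      (fun n t => - INR p * (2 * Re (zinv_pow (S p) t (PI * INR (S n)))))
      (fun n t => - INR p * (2 * (- INR (S p) * Re (zinv_pow (S (S p)) t (PI * INR (S n))))))
      (fun n => 2 * INR p * INR (S p) * / INR (S n) ^ 2)).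
    - intros n t. destruct (is_derive_zinv_pow p t _ (PI_INR_S_neq_0 n)) as [H _].
      evar_last; [apply (is_derive_scal _ t 2 _ H) |]. ring.
    - intros n t. destruct (is_derive_zinv_pow (S p) t _ (PI_INR_S_neq_0 n)) as [H _].
      evar_last; [apply is_derive_scal, is_derive_scal, H|]. ring.
    - intros n t.
      replace (- INR p * (2 * (- INR (S p) * Re (zinv_pow (S (S p)) t (PI * INR (S n))))))
        with (2 * INR p * INR (S p) * Re (zinv_pow (S (S p)) t (PI * INR (S n)))) by ring.
      rewrite Rabs_mult. assert (P := pos_INR p). assert (P1 := pos_INR (S p)).
      rewrite Rabs_right by (apply Rle_ge; repeat apply Rmult_le_pos; lra).
      apply Rmult_le_compat_l; [repeat apply Rmult_le_pos; lra|].
      eapply Rle_trans; [apply re_le_Cmod | apply Cmod_zinv_pow_le].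
    - apply ex_series_scal_R, ex_series_inv_sqr.
    - exists (mkposreal x Hx). intros t Ht. apply HF.
      change (Rabs (t - x) < x) in Ht. apply Rabs_def2 in Ht. lra.
    - exact (is_series_scal (- INR p) _ _ HL). }
  assert (E : - INR p * L = - INR p * G x).
  { rewrite <- (is_derive_unique _ _ _ D). apply is_derive_unique, HG, Hx. }
  replace (G x) with L; [exact HL|].
  apply Rmult_eq_reg_l with (- INR p); [exact E | lra].
Qed.

Lemma Re_zinv_pow_1 (x y : R) : Re (zinv_pow 1 x y) = x / (x ^ 2 + y ^ 2).
Proof. unfold zinv_pow. rewrite Cpow_1_r. reflexivity. Qed.

(** The terms are [2 x / (x^2 + (PI N)^2)] with [N = n + 1]: pairing opposite indices gives
    convergence at exponent 1. The sum is the derivative of [ln (sinh x / x)], by termwise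
    differentiation of [is_series_ln_sinh]. *)
Lemma series_zinv_pow_1 (x : R) :
  0 < x ->
  is_series (fun n => 2 * Re (zinv_pow 1 x (PI * INR (S n)))) (coth_even 0 x - / x).
Proof.
  intros Hx. assert (Hs := sinh_pos x Hx).
  assert (Hex : ex_series (fun n => 2 * Re (zinv_pow 1 x (PI * INR (S n))))).
  { apply ex_series_scal_R.
    apply ex_series_le_R with (fun n => x * / INR (S n) ^ 2);
      [|apply ex_series_scal_R, ex_series_inv_sqr].
    intros n. rewrite Re_zinv_pow_1.
    assert (HP : 1 <= PI) by (generalize PI2_1; lra).
    assert (Hn : 1 <= INR (S n)) by (rewrite S_INR; generalize (pos_INR n); lra).
    assert (Hy : INR (S n) ^ 2 <= (PI * INR (S n)) ^ 2).
    { apply pow_incr. split; [lra|]. rewrite <- (Rmult_1_l (INR (S n))) at 1.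
      apply Rmult_le_compat_r; lra. }
    assert (Hn2 : 0 < INR (S n) ^ 2) by (apply pow_lt; lra).
    assert (Hx2 := pow2_ge_0 x).
    rewrite Rabs_right.
    - apply Rmult_le_compat_l; [lra|]. apply Rinv_le_contravar; lra.
    - apply Rle_ge, Rlt_le, Rdiv_lt_0_compat; lra. }
  destruct Hex as [L HL].
  assert (D : is_derive (fun t => ln (sinh t / t)) x L).
  { apply (is_derive_series
      (fun n t => ln (1 + (t / (PI * INR (S n))) ^ 2))
      (fun n t => 2 * Re (zinv_pow 1 t (PI * INR (S n))))
      (fun n t => 2 * (- INR 1 * Re (zinv_pow 2 t (PI * INR (S n)))))
      (fun n => 2 * / INR (S n) ^ 2)).
    - intros n t. assert (Hy := PI_INR_S_neq_0 n).
      set (y := PI * INR (S n)) in *.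
      assert (Hy2 : 0 < y ^ 2) by (now apply pow2_gt_0).
      assert (Ht := pow2_ge_0 t). assert (Hty := pow2_ge_0 (t / y)).
      rewrite Re_zinv_pow_1. auto_derive; [simpl in Hty; lra|].
      field. split; [lra | exact Hy].
    - intros n t. destruct (is_derive_zinv_pow 1 t _ (PI_INR_S_neq_0 n)) as [H _].
      apply is_derive_scal, H.
    - intros n t.
      replace (2 * (- INR 1 * Re (zinv_pow 2 t (PI * INR (S n)))))
        with (- (2 * Re (zinv_pow 2 t (PI * INR (S n))))) by (simpl INR; ring).
      rewrite Rabs_Ropp, Rabs_mult, (Rabs_right 2) by lra.
      apply Rmult_le_compat_l; [lra|].
      eapply Rle_trans; [apply re_le_Cmod | apply Cmod_zinv_pow_le].
    - apply ex_series_scal_R, ex_series_inv_sqr.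
    - exists (mkposreal x Hx). intros t Ht. apply is_series_ln_sinh.
      change (Rabs (t - x) < x) in Ht. apply Rabs_def2 in Ht. lra.
    - exact HL. }
  replace (coth_even 0 x - / x) with L; [exact HL|].
  rewrite <- (is_derive_unique _ _ _ D). apply is_derive_unique.
  unfold coth_even. rewrite sum_O_R, coth_coef_0_0.
  auto_derive.
  - split; [lra|]. split; [|easy]. apply Rdiv_lt_0_compat; lra.
  - simpl. field. lra.
Qed.

Lemma is_derive_minus_inv_pow (f : R -> R) (c t df : R) (n : nat) :
  0 < t -> is_derive f t df ->
  is_derive (fun x => f x / c - / x ^ S n) t (df / c + INR (S n) / t ^ S (S n)).
Proof.
  intros Ht Hf.
  assert (H1 : is_derive (fun x => f x / c) t (df / c)).
  { apply is_derive_ext with (fun x => / c * f x); [intros; apply Rmult_comm|].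
    unfold Rdiv. rewrite (Rmult_comm df). now apply is_derive_scal. }
  assert (T0 : t ^ n <> 0) by (apply pow_nonzero; lra).
  assert (H2 : is_derive (fun x => - / x ^ S n) t (INR (S n) / t ^ S (S n))).
  { auto_derive; [apply (pow_nonzero t (S n)); lra|].
    change (match n with O => 1 | S _ => INR n + 1 end) with (INR (S n)).
    rewrite <- !tech_pow_Rmult. field. repeat split; first [assumption | lra]. }
  exact (is_derive_plus (V := R_NormedModule) _ _ _ _ _ H1 H2).
Qed.

(** Derivatives of [coth_even] and [coth_odd] are taken in alternation, each raising the exponent by
    one. The factor [2 Re] joins two opposite indices, and the subtracted power of [x] is the term
    of index 0. *)
Lemma series_zinv_pow (k : nat) (x : R) :
  0 < x ->
  is_series (fun n => 2 * Re (zinv_pow (2 * k + 1) x (PI * INR (S n))))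
    (coth_even k x / INR (fact (2 * k)) - / x ^ (2 * k + 1)) /\
  is_series (fun n => 2 * Re (zinv_pow (2 * k + 2) x (PI * INR (S n))))
    (coth_odd k x / INR (fact (2 * k + 1)) - / x ^ (2 * k + 2)).
Proof.
  assert (up : forall j,
    (forall x, 0 < x ->
      is_series (fun n => 2 * Re (zinv_pow (2 * j + 1) x (PI * INR (S n))))
        (coth_even j x / INR (fact (2 * j)) - / x ^ (2 * j + 1))) ->
    forall x, 0 < x ->
      is_series (fun n => 2 * Re (zinv_pow (2 * j + 2) x (PI * INR (S n))))
        (coth_odd j x / INR (fact (2 * j + 1)) - / x ^ (2 * j + 2))).
  { intros j Hj. replace (2 * j + 2)%nat with (S (2 * j + 1)) by lia.
    apply (series_zinv_pow_step (2 * j + 1)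
             (fun x => coth_even j x / INR (fact (2 * j)) - / x ^ (2 * j + 1))
             (fun x => coth_odd j x / INR (fact (2 * j + 1)) - / x ^ S (2 * j + 1)));
      [lia | exact Hj |].
    intros t Ht. assert (D := is_derive_coth_even j t Ht).
    assert (F0 := INR_fact_neq_0 (2 * j)).
    assert (N0 : INR (2 * j + 1) <> 0) by (apply not_0_INR; lia).
    assert (T0 : t ^ (2 * j) <> 0) by (apply pow_nonzero; lra).
    replace (2 * j + 1)%nat with (S (2 * j)) in * by lia.
    evar_last.
    - apply is_derive_minus_inv_pow; [exact Ht | exact D].
    - rewrite INR_fact_S, <- !tech_pow_Rmult.
      field. repeat split; first [assumption | lra]. }
  assert (odd : forall j t, 0 < t ->
      is_series (fun n => 2 * Re (zinv_pow (2 * j + 1) t (PI * INR (S n))))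
        (coth_even j t / INR (fact (2 * j)) - / t ^ (2 * j + 1))).
  { induction j as [|j IH]; intros t Ht.
    - assert (H := series_zinv_pow_1 t Ht).
      replace (coth_even 0 t / INR (fact (2 * 0)) - / t ^ (2 * 0 + 1))
        with (coth_even 0 t - / t) by (simpl; field; lra). exact H.
    - replace (2 * S j + 1)%nat with (S (2 * j + 2)) by lia.
      revert t Ht.
      apply (series_zinv_pow_step (2 * j + 2)
             (fun x => coth_odd j x / INR (fact (2 * j + 1)) - / x ^ (2 * j + 2))
             (fun x => coth_even (S j) x / INR (fact (2 * S j)) - / x ^ S (2 * j + 2)));
        [lia | exact (up j IH) |].
      intros t Ht. assert (D := is_derive_coth_odd j t Ht).
      assert (F0 := INR_fact_neq_0 (2 * j + 1)).
      assert (N0 : INR (2 * j + 2) <> 0) by (apply not_0_INR; lia).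
      assert (T0 : t ^ (2 * j + 1) <> 0) by (apply pow_nonzero; lra).
      replace (2 * S j)%nat with (S (2 * j + 1)) by lia.
      replace (2 * j + 2)%nat with (S (2 * j + 1)) in * by lia.
      evar_last.
      + apply is_derive_minus_inv_pow; [exact Ht | exact D].
      + rewrite INR_fact_S, <- !tech_pow_Rmult.
        field. repeat split; first [assumption | lra]. }
  intros Hx. split; [now apply odd | apply up; [apply odd | exact Hx]].
Qed.

(** * The lattice sum *)

Lemma is_series_C (u : nat -> C) (s : C) :
  is_series (fun n => Re (u n)) (Re s) -> is_series (fun n => Im (u n)) (Im s) ->
  is_series u s.
Proof.
  intros H1 H2 P [e He].
  destruct (H1 (ball (Re s) e) (locally_ball _ e)) as [N1 HN1].
  destruct (H2 (ball (Im s) e) (locally_ball _ e)) as [N2 HN2].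
  exists (max N1 N2). intros n Hn.
  assert (E : sum_n u n = (sum_n (fun i => Re (u i)) n, sum_n (fun i => Im (u i)) n)).
  { clear. induction n as [|n IH].
    - rewrite !sum_O. apply surjective_pairing.
    - rewrite !sum_Sn, IH. reflexivity. }
  apply He. change (ball (M := C_UniformSpace) s e (sum_n (G := C_AbelianMonoid) u n)).
  rewrite E. split; [apply HN1 | apply HN2]; lia.
Qed.

Lemma ex_series_C_le (u : nat -> C) (v : nat -> R) :
  (forall n, Cmod (u n) <= v n) -> ex_series v -> ex_series u.
Proof.
  intros H Hv.
  exists (Series (fun n => Re (u n)), Series (fun n => Im (u n))).
  apply is_series_C; apply Series_correct; apply ex_series_le_R with (2 := Hv);
    intros n; (eapply Rle_trans; [|apply H]).
  - apply re_le_Cmod.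
  - apply Im_le_Cmod.
Qed.

Lemma is_series_C_plus (u v : nat -> C) (s t : C) :
  is_series u s -> is_series v t -> is_series (fun n => (u n + v n)%C) (s + t)%C.
Proof. exact (is_series_plus (V := C_NormedModule) u v s t). Qed.

Lemma is_series_C_scal (c : C) (u : nat -> C) (s : C) :
  is_series u s -> is_series (fun n => (c * u n)%C) (c * s)%C.
Proof. exact (is_series_scal (V := C_NormedModule) c u s). Qed.

Lemma is_series_C_ext (u v : nat -> C) (s : C) :
  (forall n, u n = v n) -> is_series u s -> is_series v s.
Proof. exact (is_series_ext (V := C_NormedModule) u v s). Qed.

Lemma zinv_pow_opp (p : nat) (x y : R) :
  zinv_pow p x (- y) = Cconj (zinv_pow p x y).
Proof.
  unfold zinv_pow. rewrite Cpow_conj. f_equal.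
  unfold Cinv, Cconj; simpl. f_equal.
  - f_equal. f_equal. ring.
  - unfold Rdiv. rewrite Ropp_mult_distr_l. f_equal. f_equal. f_equal. ring.
Qed.

Lemma zinv_pow_neg (p : nat) (x y : R) :
  zinv_pow p (- x) y = (RtoC ((-1) ^ p) * Cconj (zinv_pow p x y))%C.
Proof.
  unfold zinv_pow. rewrite RtoC_pow, Cpow_conj, <- Cpow_mult_l. f_equal.
  unfold Cinv, Cconj, Cmult, RtoC; simpl.
  replace (- x * (- x * 1)) with (x * (x * 1)) by ring.
  unfold Rdiv. f_equal; ring.
Qed.

Lemma Re_zinv_pow_neg (p : nat) (x y : R) :
  Re (zinv_pow p (- x) y) = (-1) ^ p * Re (zinv_pow p x y).
Proof.
  rewrite zinv_pow_neg. unfold Re, Cmult, Cconj, RtoC. cbn [fst snd]. ring.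
Qed.

(** Opposite indices give conjugate terms, so the imaginary parts of the two halves cancel. The
    exponent is at least 2, hence each half converges by itself. *)
Lemma is_series_Z_zinv_pow (p : nat) (x V : R) :
  x <> 0 ->
  is_series (fun n => 2 * Re (zinv_pow (S (S p)) x (PI * INR (S n))))
    (V - / x ^ S (S p)) ->
  is_series_Z (fun n => zinv_pow (S (S p)) x (PI * IZR n)) (RtoC V).
Proof.
  intros Hx HV. set (z := fun n => zinv_pow (S (S p)) x (PI * INR (S n))).
  assert (Hz : forall n, Cmod (z n) <= / INR (S n) ^ 2) by (intros; apply Cmod_zinv_pow_le).
  set (A := Series (fun n => Re (z n))). set (B := Series (fun n => Im (z n))).
  assert (HA : is_series (fun n => Re (z n)) A).
  { apply Series_correct, (ex_series_le_R _ _) with (2 := ex_series_inv_sqr).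
    intros n. eapply Rle_trans; [apply re_le_Cmod | apply Hz]. }
  assert (HB : is_series (fun n => Im (z n)) B).
  { apply Series_correct, (ex_series_le_R _ _) with (2 := ex_series_inv_sqr).
    intros n. eapply Rle_trans; [apply Im_le_Cmod | apply Hz]. }
  assert (EA : 2 * A = V - / x ^ S (S p)).
  { rewrite <- (is_series_unique _ _ HV). symmetry. apply is_series_unique.
    exact (is_series_scal 2 _ _ HA). }
  assert (E0 : zinv_pow (S (S p)) x (PI * IZR 0) = RtoC (/ x ^ S (S p))).
  { rewrite Rmult_0_r. unfold zinv_pow. change (x, 0) with (RtoC x).
    rewrite <- RtoC_inv, <- RtoC_pow by exact Hx. now rewrite pow_inv. }
  (* The first half also contains the term of index 0, which is real. *)
  exists (A + / x ^ S (S p), B), (A, - B). split; [|split].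
  - apply is_series_decr_1.
    apply is_series_ext with z.
    + intros n. unfold z. now rewrite INR_IZR_INZ.
    + change (Z.of_nat 0) with 0%Z. rewrite E0.
      apply is_series_C; unfold plus, opp; simpl.
      * replace (A + / _ + - / _) with A by ring. exact HA.
      * replace (B + - 0) with B by ring. exact HB.
  - apply is_series_ext with (fun n => Cconj (z n)).
    + intros n. unfold z. rewrite <- zinv_pow_opp. f_equal.
      rewrite opp_IZR, INR_IZR_INZ. ring.
    + apply is_series_C; [exact HA|]. exact (is_series_opp _ _ HB).
  - unfold Cplus, RtoC; cbn [fst snd]. f_equal; [|ring].
    lra.
Qed.

Lemma sinh_opp (x : R) : sinh (- x) = - sinh x.
Proof. unfold sinh. rewrite Ropp_involutive. field. Qed.

Lemma cosh_opp (x : R) : cosh (- x) = cosh x.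
Proof. unfold cosh. rewrite Ropp_involutive, Rplus_comm. reflexivity. Qed.

Lemma pow_opp_even (x : R) (n : nat) : (- x) ^ (2 * n) = x ^ (2 * n).
Proof. rewrite !pow_mult. f_equal. ring. Qed.

Lemma pow_opp_odd (x : R) (n : nat) : (- x) ^ (2 * n + 1) = - x ^ (2 * n + 1).
Proof. rewrite !pow_add, pow_opp_even. ring. Qed.

Lemma coth_odd_opp (k : nat) (x : R) : coth_odd k (- x) = coth_odd k x.
Proof.
  apply sum_n_ext. intros l. rewrite sinh_opp.
  replace (2 * l + 2)%nat with (2 * (l + 1))%nat by lia. now rewrite pow_opp_even.
Qed.

Lemma coth_even_opp (k : nat) (x : R) :
  coth_even k (- x) = - coth_even k x.
Proof.
  unfold coth_even.
  rewrite <- (Rmult_1_l (sum_n (fun l => _ * (cosh x / _)) k)), Ropp_mult_distr_l,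
    <- sum_n_scal_R.
  apply sum_n_ext. intros l.
  rewrite sinh_opp, cosh_opp, pow_opp_odd. unfold Rdiv. rewrite Rinv_opp.
  generalize (/ sinh x ^ (2 * l + 1)). intros r. simpl. ring.
Qed.

(** The condition on [k] excludes exponent 1, for which the one-sided series diverge. *)
Lemma series_Z_odd (k : nat) (x : R) :
  (1 <= k)%nat -> x <> 0 ->
  is_series_Z (fun n => zinv_pow (2 * k + 1) x (PI * IZR n))
    (RtoC (coth_even k x / INR (fact (2 * k)))).
Proof.
  intros Hk Hx.
  assert (E : exists p, (2 * k + 1)%nat = S (S p)) by (exists (2 * k - 1)%nat; lia).
  assert (H : is_series (fun n => 2 * Re (zinv_pow (2 * k + 1) x (PI * INR (S n))))
    (coth_even k x / INR (fact (2 * k)) - / x ^ (2 * k + 1))).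
  (* Both sides are odd in [x], so a negative [x] is handled by the identity at [- x] multiplied by
     [-1]. *)
  { destruct (Rlt_le_dec 0 x) as [H|H]; [exact (proj1 (series_zinv_pow k x H))|].
    assert (H' : 0 < - x) by lra.
    destruct (series_zinv_pow k (- x) H') as [S1 _].
    apply (is_series_scal (-1)) in S1.
    replace (coth_even k x / INR (fact (2 * k)) - / x ^ (2 * k + 1)) with
     (scal (-1) (coth_even k (- x) / INR (fact (2 * k)) - / (- x) ^ (2 * k + 1))).
    - eapply is_series_ext; [|exact S1]. intros n. cbn beta.
      rewrite Re_zinv_pow_neg, Nat.add_1_r, pow_1_odd.
      unfold scal, mult; cbn -[Nat.mul zinv_pow Re INR]. ring.
    - rewrite coth_even_opp, pow_opp_odd, Rinv_opp.
      unfold scal, mult; cbn -[Nat.mul coth_even INR fact pow]. unfold Rdiv. ring. }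
  destruct E as [p E]. rewrite E in *. now apply is_series_Z_zinv_pow.
Qed.

Lemma series_Z_even (k : nat) (x : R) :
  x <> 0 ->
  is_series_Z (fun n => zinv_pow (2 * k + 2) x (PI * IZR n))
    (RtoC (coth_odd k x / INR (fact (2 * k + 1)))).
Proof.
  intros Hx.
  assert (E : exists p, (2 * k + 2)%nat = S (S p)) by (exists (2 * k)%nat; lia).
  assert (H : is_series (fun n => 2 * Re (zinv_pow (2 * k + 2) x (PI * INR (S n))))
    (coth_odd k x / INR (fact (2 * k + 1)) - / x ^ (2 * k + 2))).
  { destruct (Rlt_le_dec 0 x) as [H|H]; [exact (proj2 (series_zinv_pow k x H))|].
    assert (H' : 0 < - x) by lra.
    destruct (series_zinv_pow k (- x) H') as [_ S1].
    rewrite coth_odd_opp in S1.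
    replace (2 * k + 2)%nat with (2 * (k + 1))%nat in * by lia.
    rewrite pow_opp_even in S1.
    eapply is_series_ext; [|exact S1]. intros n. cbn beta.
    now rewrite Re_zinv_pow_neg, pow_1_even, Rmult_1_l. }
  destruct E as [p E]. rewrite E in *. now apply is_series_Z_zinv_pow.
Qed.

(** * Linearity of sums over the integers *)

Lemma is_series_Z_scal (c : C) (u v : Z -> C) (s : C) :
  (forall n, v n = (c * u n)%C) -> is_series_Z u s -> is_series_Z v (c * s)%C.
Proof.
  intros E (s1 & s2 & H1 & H2 & ->). exists (c * s1)%C, (c * s2)%C.
  split; [|split; [|ring]].
  - eapply is_series_C_ext; [|apply is_series_C_scal, H1]. intros n. now rewrite E.
  - eapply is_series_C_ext; [|apply is_series_C_scal, H2]. intros n. now rewrite E.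
Qed.

Lemma is_series_Znz_scal (c : C) (u v : Z -> C) (s : C) :
  (forall n, v n = (c * u n)%C) -> is_series_Znz u s -> is_series_Znz v (c * s)%C.
Proof.
  intros E (s1 & s2 & H1 & H2 & ->). exists (c * s1)%C, (c * s2)%C.
  split; [|split; [|ring]].
  - eapply is_series_C_ext; [|apply is_series_C_scal, H1]. intros n. now rewrite E.
  - eapply is_series_C_ext; [|apply is_series_C_scal, H2]. intros n. now rewrite E.
Qed.

Lemma is_series_Znz_sum (u : nat -> Z -> C) (s : nat -> C) (k : nat) :
  (1 <= k)%nat ->
  (forall l, (1 <= l <= k)%nat -> is_series_Znz (u l) (s l)) ->
  is_series_Znz (fun m => sum_n_m (fun l => u l m) 1 k) (sum_n_m s 1 k).
Proof.
  intros Hk. induction k as [|k IH]; [lia|]. intros H.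
  destruct (Nat.eq_dec k 0) as [->|Hk0].
  - destruct (H 1%nat) as (s1 & s2 & H1 & H2 & E); [lia|].
    exists s1, s2. rewrite sum_n_n. split; [|split; [|exact E]].
    + eapply is_series_C_ext; [|exact H1]. intros n. now rewrite sum_n_n.
    + eapply is_series_C_ext; [|exact H2]. intros n. now rewrite sum_n_n.
  - destruct IH as (s1 & s2 & H1 & H2 & E); [lia | intros; apply H; lia |].
    destruct (H (S k)) as (t1 & t2 & T1 & T2 & ET); [lia|].
    exists (s1 + t1)%C, (s2 + t2)%C. split; [|split].
    + eapply is_series_C_ext; [|apply is_series_C_plus; [exact H1 | exact T1]].
      intros n. now rewrite sum_n_Sm by lia.
    + eapply is_series_C_ext; [|apply is_series_C_plus; [exact H2 | exact T2]].
      intros n. now rewrite sum_n_Sm by lia.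
    + rewrite sum_n_Sm, E, ET by lia. unfold plus; simpl. ring.
Qed.

(** Already [eps = 1] gives [|g m| <= 1 / |m| <= 1] beyond some [M]; only finitely many indices
    remain. *)
Lemma little_o_inv_bounded (g : Z -> C) :
  little_o_inv g -> exists G, forall m, m <> 0%Z -> Cmod (g m) <= G.
Proof.
  intros Hg. destruct (Hg 1 Rlt_0_1) as [M HM].
  assert (fin : forall N : nat, exists G, forall m, (Z.abs m <= Z.of_nat N)%Z -> Cmod (g m) <= G).
  { induction N as [|N [G HG]].
    - exists (Cmod (g 0%Z)). intros m Hm. replace m with 0%Z by lia. lra.
    - exists (Rmax G (Rmax (Cmod (g (Z.of_nat (S N)))) (Cmod (g (- Z.of_nat (S N))%Z)))).
      intros m Hm.
      destruct (Z_le_gt_dec (Z.abs m) (Z.of_nat N)) as [H|H].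
      + eapply Rle_trans; [now apply HG | apply Rmax_l].
      + eapply Rle_trans; [|apply Rmax_r].
        assert (Hm' : m = Z.of_nat (S N) \/ m = (- Z.of_nat (S N))%Z) by lia.
        destruct Hm' as [-> | ->]; [apply Rmax_l | apply Rmax_r]. }
  destruct (fin (Z.to_nat (up M))) as [G HG]. exists (Rmax G 1). intros m Hm.
  destruct (Rle_lt_dec M (Rabs (IZR m))) as [H|H].
  - eapply Rle_trans; [now apply HM|]. eapply Rle_trans; [|apply Rmax_r].
    rewrite Rmult_1_l, Rabs_inv, <- abs_IZR, <- Rinv_1.
    apply Rinv_le_contravar; [lra|]. apply IZR_le. lia.
  - eapply Rle_trans; [|apply Rmax_l]. apply HG.
    rewrite <- abs_IZR in H. destruct (archimed M) as [H1 _].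
    assert (Z.abs m < up M)%Z by (apply lt_IZR; lra). lia.
Qed.

(** Folds the sum over nonzero integers onto the positive ones, with [eps = 1] for even [tau] and
    [eps = -1] for odd [tau]. Boundedness of [g] and the decay of [tau] make both halves converge
    absolutely. *)
Lemma is_series_Znz_parity (g : Z -> C) (tau : Z -> R) (eps : C) (G M : R) :
  (forall m, m <> 0%Z -> Cmod (g m) <= G) ->
  (forall m, RtoC (tau (- m)%Z) = (eps * RtoC (tau m))%C) ->
  (forall n, Rabs (tau (Z.of_nat (S n))) <= M * / INR (S n) ^ 2) ->
  let w := fun n => ((g (Z.of_nat (S n)) + eps * g (- Z.of_nat (S n))%Z)
                     * RtoC (tau (Z.of_nat (S n))))%C in
  ex_series w /\ is_series_Znz (fun m => (g m * RtoC (tau m))%C) (CSeries w).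
Proof.
  intros HG Heps HM w.
  assert (P : forall h : nat -> C, (forall n, Cmod (h n) <= G) ->
    ex_series (fun n => (h n * RtoC (tau (Z.of_nat (S n))))%C)).
  { intros h Hh. apply ex_series_C_le with (fun n => (G * M) * / INR (S n) ^ 2);
      [|apply ex_series_scal_R, ex_series_inv_sqr].
    intros n. rewrite Cmod_mult, Cmod_R, Rmult_assoc.
    apply Rmult_le_compat; [apply Cmod_ge_0 | apply Rabs_pos | apply Hh | apply HM]. }
  destruct (P (fun n => g (Z.of_nat (S n)))) as [s1 H1]; [intros; apply HG; lia|].
  destruct (P (fun n => g (- Z.of_nat (S n))%Z)) as [s2 H2]; [intros; apply HG; lia|].
  apply (is_series_C_scal eps) in H2.
  assert (W : is_series w (s1 + eps * s2)%C).
  { eapply is_series_C_ext; [|exact (is_series_C_plus _ _ _ _ H1 H2)].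
    intros n. unfold w. cbn beta. ring. }
  split; [exists (s1 + eps * s2)%C; exact W|].
  rewrite (CSeries_unique _ _ W). exists s1, (eps * s2)%C.
  split; [exact H1 | split; [|reflexivity]].
  eapply is_series_C_ext; [|exact H2]. intros n. cbn beta. rewrite Heps. ring.
Qed.

(** The mean value theorem, with [cosh >= 1]. *)
Lemma Rabs_sinh_ge (x : R) : Rabs x <= Rabs (sinh x).
Proof.
  destruct (MVT_gen sinh 0 x cosh) as [xi [_ E]].
  - intros; auto_derive; [easy | ring].
  - intros y _. apply continuity_pt_filterlim.
    apply (ex_derive_continuous (V := R_NormedModule) sinh). auto_derive. easy.
  - rewrite sinh_0, !Rminus_0_r in E. rewrite E, Rabs_mult.
    assert (H := cosh_ge_1 xi). rewrite (Rabs_right (cosh xi)) by lra.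
    rewrite <- (Rmult_1_l (Rabs x)) at 1. apply Rmult_le_compat_r; [apply Rabs_pos | lra].
Qed.

Lemma inv_sinh_pow_bound (c : R) (p n : nat) :
  c <> 0 -> (2 <= p)%nat ->
  Rabs (/ sinh (INR (S n) * c) ^ p) <= (/ Rabs c) ^ p * / INR (S n) ^ 2.
Proof.
  intros Hc Hp. assert (Pc := Rabs_pos_lt c Hc).
  assert (Hn : 1 <= INR (S n)) by (rewrite S_INR; generalize (pos_INR n); lra).
  rewrite Rabs_inv, <- RPow_abs, <- pow_inv.
  apply Rle_trans with ((/ (INR (S n) * Rabs c)) ^ p).
  - apply pow_incr. split.
    + apply Rlt_le, Rinv_0_lt_compat. eapply Rlt_le_trans; [|apply Rabs_sinh_ge].
      apply Rabs_pos_lt, Rmult_integral_contrapositive_currified; lra.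
    + apply Rinv_le_contravar; [apply Rmult_lt_0_compat; lra|].
      eapply Rle_trans; [|apply Rabs_sinh_ge]. rewrite Rabs_mult, (Rabs_right (INR _)); lra.
  - rewrite Rinv_mult, Rpow_mult_distr, Rmult_comm.
    apply Rmult_le_compat_l.
    + apply pow_le, Rlt_le, Rinv_0_lt_compat, Pc.
    + replace p with (2 + (p - 2))%nat by lia. rewrite pow_add, <- pow_inv.
      rewrite <- (Rmult_1_r ((/ INR (S n)) ^ 2)) at 2.
      assert (I : 0 <= / INR (S n) <= 1).
      { split; [apply Rlt_le, Rinv_0_lt_compat; lra|].
        rewrite <- Rinv_1. apply Rinv_le_contravar; lra. }
      apply Rmult_le_compat_l; [apply pow_le; lra|].
      rewrite <- (pow1 (p - 2)). apply pow_incr. lra.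
Qed.

(** [cosh <= 1 + |sinh|] reduces the quotient to reciprocals of [sinh^(p + 1)] and [sinh^p], both
    covered by [inv_sinh_pow_bound]. *)
Lemma cosh_sinh_pow_bound (c : R) (p n : nat) :
  c <> 0 -> (2 <= p)%nat ->
  Rabs (cosh (INR (S n) * c) / sinh (INR (S n) * c) ^ (p + 1))
  <= ((/ Rabs c) ^ (p + 1) + (/ Rabs c) ^ p) * / INR (S n) ^ 2.
Proof.
  intros Hc Hp. assert (Pc := Rabs_pos_lt c Hc).
  assert (Hn : 1 <= INR (S n)) by (rewrite S_INR; generalize (pos_INR n); lra).
  assert (B1 := inv_sinh_pow_bound c (p + 1) n Hc ltac:(lia)).
  assert (B2 := inv_sinh_pow_bound c p n Hc Hp).
  set (x := INR (S n) * c) in *.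
  assert (Hs : sinh x <> 0).
  { intros E. assert (H := Rabs_sinh_ge x). rewrite E, Rabs_R0 in H.
    assert (0 < Rabs x); [|lra].
    apply Rabs_pos_lt, Rmult_integral_contrapositive_currified; lra. }
  assert (Hch : Rabs (cosh x) <= 1 + Rabs (sinh x)).
  { assert (H1 := cosh_ge_1 x). rewrite Rabs_right by lra.
    assert (H2 := cosh_sqr x). rewrite <- (pow2_abs (sinh x)) in H2.
    assert (H3 := Rabs_pos (sinh x)). nra. }
  unfold Rdiv. rewrite Rabs_mult.
  eapply Rle_trans; [apply Rmult_le_compat_r; [apply Rabs_pos | exact Hch]|].
  replace ((1 + Rabs (sinh x)) * Rabs (/ sinh x ^ (p + 1)))
    with (Rabs (/ sinh x ^ (p + 1)) + Rabs (/ sinh x ^ p)); [lra|].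
  replace (Rabs (/ sinh x ^ p)) with (Rabs (sinh x) * Rabs (/ sinh x ^ (p + 1))); [ring|].
  rewrite <- Rabs_mult. f_equal. rewrite pow_add. field.
  split; [now apply pow_nonzero | exact Hs].
Qed.

(** * Rearrangement of the finite sums *)

Lemma sum_n_m_RtoC_mult (r : nat -> R) (X : C) (s k : nat) :
  sum_n_m (fun j => (RtoC (r j) * X)%C) s k = (RtoC (sum_n_m r s k) * X)%C.
Proof.
  rewrite (sum_n_m_mult_r (K := C_Ring) X (fun j => RtoC (r j))).
  unfold mult; simpl. f_equal.
  destruct (le_lt_dec s k) as [H|H]; [|now rewrite !sum_n_m_zero by lia].
  induction k as [|k IH].
  - replace s with 0%nat by lia. now rewrite !sum_n_n.
  - destruct (Nat.eq_dec s (S k)) as [->|Hk]; [now rewrite !sum_n_n|].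
    rewrite !sum_n_Sm, IH by lia. unfold plus; simpl. now rewrite RtoC_plus.
Qed.

Lemma RtoC_mult_swap (r t : R) (z : C) :
  (RtoC r * (z * RtoC t))%C = (RtoC (r * t) * z)%C.
Proof. rewrite RtoC_mult. ring. Qed.

(** Summing over [j] first collects the coefficient of each [X l]. The identity is purely algebraic,
    so it also covers the value that [CSeries] assigns to a divergent series. *)
Lemma sum_n_m_triangle_coef (k s : nat) (f : nat -> R) (c : nat -> nat -> R) (X : nat -> C) :
  (forall j l, (s <= l <= j)%nat -> c j l = f l * (coth_weight k l j * Sjl j l)) ->
  sum_n_m (fun j => sum_n_m (fun l => (RtoC (c j l) * X l)%C) s j) s k =
  sum_n_m (fun l => (RtoC (f l * coth_coef k l) * X l)%C) s k.
Proof.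
  intros Hc. rewrite (sum_n_m_triangle (fun j l => (RtoC (c j l) * X l)%C)).
  apply sum_n_m_ext_loc. intros l Hl. rewrite sum_n_m_RtoC_mult. do 2 f_equal.
  rewrite (sum_n_m_ext_loc _ (fun j => f l * (coth_weight k l j * Sjl j l)))
    by (intros j Hj; apply Hc; lia).
  rewrite <- (coth_coef_trunc k l) by lia.
  exact (sum_n_m_mult_l (K := R_Ring) (f l) _ l k).
Qed.

Lemma coth_even_sum (k : nat) (x : R) :
  (1 <= k)%nat ->
  coth_even k x = sum_n_m (fun l => INR (fact (2 * l)) * coth_coef k l
                                    * (cosh x / sinh x ^ (2 * l + 1))) 1 k.
Proof.
  intros Hk. unfold coth_even, sum_n. rewrite (sum_Sn_m _ 0 k) by lia.
  destruct k as [|k]; [lia|]. rewrite coth_coef_succ_0, Rmult_0_r, Rmult_0_l.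
  apply (plus_zero_l (G := R_AbelianMonoid)).
Qed.

Lemma coth_odd_sum (k : nat) (x : R) :
  coth_odd k x = sum_n_m (fun l => INR (fact (2 * l - 1)) * coth_coef (S k) l
                                   * / sinh x ^ (2 * l)) 1 (S k).
Proof.
  rewrite <- sum_n_m_S. apply sum_n_ext. intros l.
  replace (2 * S l - 1)%nat with (2 * l + 1)%nat by lia.
  now replace (2 * S l)%nat with (2 * l + 2)%nat by lia.
Qed.

(** [m + a n i = (a / PI) (x + i PI n)] with [x = m PI / a]. *)
Lemma lattice_term (g : Z -> C) (a : R) (p : nat) (m n : Z) :
  a <> 0 -> m <> 0%Z ->
  (g m / Cpow (RtoC (IZR m) + RtoC a * RtoC (IZR n) * Ci) p)%C =
  (g m * RtoC ((PI / a) ^ p) * zinv_pow p (IZR m * PI / a) (PI * IZR n))%C.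
Proof.
  intros Ha Hm. assert (HP := PI_neq0). assert (Hm' := eq_IZR_contrapositive m 0%Z Hm).
  unfold zinv_pow, Cdiv. rewrite RtoC_pow, <- (Cmult_assoc (g m)). f_equal.
  assert (Hz : (RtoC (IZR m) + RtoC a * RtoC (IZR n) * Ci)%C <> RtoC 0).
  { intros E. apply (f_equal Re) in E. simpl in E. apply Hm'. lra. }
  rewrite <- Cpow_inv, <- Cpow_mult_l by exact Hz. f_equal.
  replace ((IZR m * PI / a, PI * IZR n) : C) with
    (RtoC (PI / a) * (RtoC (IZR m) + RtoC a * RtoC (IZR n) * Ci))%C.
  - assert (Hpa : RtoC (PI / a) <> RtoC 0).
    { intros E. apply RtoC_inj in E. apply Rmult_integral in E.
      destruct E as [E|E]; [easy|]. now apply (Rinv_neq_0_compat a). }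
    field. split; assumption.
  - unfold Cmult, Cplus, RtoC, Ci; simpl. f_equal; field; exact Ha.
Qed.

Theorem theorem3p2 (g : Z -> C) (k : nat) (a : R)
  (hg : little_o_inv g) (hk : (1 <= k)%nat) (ha : a <> 0) :
  let even_term (l n : nat) : C :=
    let m := S n in
    ((g (Z.of_nat m) + g (- Z.of_nat m)%Z)
       / RtoC (sinh (INR m * PI / a) ^ (2 * l)))%C in
  let odd_term (l n : nat) : C :=
    let m := S n in
    ((g (Z.of_nat m) - g (- Z.of_nat m)%Z) * RtoC (cosh (INR m * PI / a))
       / RtoC (sinh (INR m * PI / a) ^ (2 * l + 1)))%C in
  ((forall l : nat, (1 <= l <= k)%nat -> ex_series (even_term l)) /\
   is_iterated_sum
     (fun m n =>
        (g m / Cpow (RtoC (IZR m) + RtoC a * RtoC (IZR n) * Ci) (2 * k))%C)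
     (RtoC (PI ^ (2 * k) / (a ^ (2 * k) * INR (fact (2 * k - 1))))
      * sum_n_m (fun j => sum_n_m (fun l =>
          RtoC ((binom (2 * k) (2 * j) * INR (fact (2 * l - 1))
                 - binom (2 * k) (2 * j + 1) * INR (fact (2 * l - 1))
                     * INR (2 * l + 1))
                * Sjl j l)
          * CSeries (even_term l)) 1 j) 1 k)%C)
  /\
  ((forall l : nat, (1 <= l <= k)%nat -> ex_series (odd_term l)) /\
   is_iterated_sum
     (fun m n =>
        (g m / Cpow (RtoC (IZR m) + RtoC a * RtoC (IZR n) * Ci) (2 * k + 1))%C)
     (RtoC (PI ^ (2 * k + 1) / (a ^ (2 * k + 1) * INR (fact (2 * k))))
      * sum_n_m (fun j => sum_n_m (fun l =>
          RtoC ((binom (2 * k) (2 * j) * INR (fact (2 * l))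
                 - binom (2 * k) (2 * j + 1) * INR (fact (2 * l + 1)))
                * Sjl j l)
          * CSeries (odd_term l)) 0 j) 0 k)%C).
Proof.
  intros even_term odd_term.
  assert (HP := PI_neq0).
  assert (Hc : PI / a <> 0).
  { apply Rmult_integral_contrapositive_currified; [exact HP | now apply Rinv_neq_0_compat]. }
  destruct (little_o_inv_bounded g hg) as [G HG].
  assert (Hx : forall m, m <> 0%Z -> IZR m * PI / a <> 0).
  { intros m Hm. unfold Rdiv. rewrite Rmult_assoc.
    apply Rmult_integral_contrapositive_currified; [now apply eq_IZR_contrapositive | exact Hc]. }
  assert (Hs : forall n, sinh (INR (S n) * PI / a) <> 0).
  { intros n E. assert (H := Rabs_sinh_ge (INR (S n) * PI / a)).
    rewrite E, Rabs_R0, INR_IZR_INZ in H.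
    assert (H' := Rabs_pos_lt _ (Hx (Z.of_nat (S n)) ltac:(lia))). lra. }
  split.
  - set (tau := fun l m => / sinh (IZR m * PI / a) ^ (2 * l)).
    assert (Heven : forall l, (1 <= l <= k)%nat -> ex_series (even_term l) /\
      is_series_Znz (fun m => (g m * RtoC (tau l m))%C) (CSeries (even_term l))).
    { intros l Hl.
      destruct (is_series_Znz_parity g (tau l) (RtoC 1) G ((/ Rabs (PI / a)) ^ (2 * l)) HG)
        as [P1 P2].
      - intros m. unfold tau. rewrite Cmult_1_l, opp_IZR. unfold Rdiv.
        now rewrite !Ropp_mult_distr_l_reverse, sinh_opp, pow_opp_even.
      - intros n. unfold tau, Rdiv. rewrite <- INR_IZR_INZ, Rmult_assoc.
        apply inv_sinh_pow_bound; [exact Hc | lia].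
      - assert (E : forall n, even_term l n =
          ((g (Z.of_nat (S n)) + RtoC 1 * g (- Z.of_nat (S n))%Z)
           * RtoC (tau l (Z.of_nat (S n))))%C).
        { intros n. unfold even_term, tau, Cdiv.
          rewrite <- INR_IZR_INZ, RtoC_inv, Cmult_1_l by (apply pow_nonzero, Hs).
          reflexivity. }
        destruct P1 as [w Hw].
        assert (Hw' : is_series (even_term l) w).
        { eapply is_series_C_ext; [|exact Hw]. intros n. now rewrite E. }
        split; [now exists w|].
        rewrite (CSeries_unique _ _ Hw'), <- (CSeries_unique _ _ Hw). exact P2. }
    split; [intros l Hl; now apply Heven|].
    rewrite (sum_n_m_triangle_coef k 1 (fun l => INR (fact (2 * l - 1)))
      (fun j l => (binom (2 * k) (2 * j) * INR (fact (2 * l - 1))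
                 - binom (2 * k) (2 * j + 1) * INR (fact (2 * l - 1))
                     * INR (2 * l + 1)) * Sjl j l))
      by (intros j l Hl; unfold coth_weight; ring).
    (* The inner sum at [m], expanded over [l] so that the outer sum can be taken term by term. *)
    exists (fun m => (RtoC (PI ^ (2 * k) / (a ^ (2 * k) * INR (fact (2 * k - 1))))
      * sum_n_m (fun l => (RtoC (INR (fact (2 * l - 1)) * coth_coef k l)
                           * (g m * RtoC (tau l m)))%C) 1 k)%C).
    split.
    (* The exponent [2 k] is [2 k' + 2], so the derivative of [coth] involved has order
       [2 k' + 1]. *)
    + intros m Hm. destruct k as [|k']; [lia|].
      rewrite (sum_n_m_ext _ (fun l => (RtoC (INR (fact (2 * l - 1)) * coth_coef (S k') l
        * tau l m) * g m)%C)) by (intros l; apply RtoC_mult_swap).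
      rewrite sum_n_m_RtoC_mult. unfold tau. rewrite <- coth_odd_sum.
      replace (2 * S k' - 1)%nat with (2 * k' + 1)%nat by lia.
      replace (2 * S k')%nat with (2 * k' + 2)%nat by lia.
      assert (H := is_series_Z_scal (g m * RtoC ((PI / a) ^ (2 * k' + 2))) _ _ _
        (fun n => lattice_term g a (2 * k' + 2) m n ha Hm)
        (series_Z_even k' _ (Hx m Hm))).
      replace (RtoC _ * (RtoC _ * g m))%C with
        (g m * RtoC ((PI / a) ^ (2 * k' + 2)) *
         RtoC (coth_odd k' (IZR m * PI / a) / INR (fact (2 * k' + 1))))%C; [exact H|].
      rewrite <- Cmult_assoc, <- RtoC_mult, Cmult_comm, Cmult_assoc, <- RtoC_mult.
      do 2 f_equal. unfold Rdiv. rewrite Rpow_mult_distr, pow_inv, Rinv_mult. ring.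
    + eapply is_series_Znz_scal; [intros m; reflexivity|].
      apply (is_series_Znz_sum (fun l m => (RtoC (INR (fact (2 * l - 1)) * coth_coef k l)
                           * (g m * RtoC (tau l m)))%C)); [exact hk|].
      intros l Hl. eapply is_series_Znz_scal; [intros m; reflexivity|].
      now apply Heven.
  - set (tau := fun l m => cosh (IZR m * PI / a) / sinh (IZR m * PI / a) ^ (2 * l + 1)).
    assert (Hodd : forall l, (1 <= l <= k)%nat -> ex_series (odd_term l) /\
      is_series_Znz (fun m => (g m * RtoC (tau l m))%C) (CSeries (odd_term l))).
    { intros l Hl.
      (* [tau l] is odd here, whence the difference [g m - g (- m)]. Its bound is that of
         [cosh_sinh_pow_bound] at [p = 2 l], which is at least 2 because [l >= 1]. *)
      destruct (is_series_Znz_parity g (tau l) (RtoC (-1)) G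
        ((/ Rabs (PI / a)) ^ (2 * l + 1) + (/ Rabs (PI / a)) ^ (2 * l)) HG) as [P1 P2].
      - intros m. unfold tau. rewrite <- RtoC_mult, opp_IZR. unfold Rdiv.
        rewrite !Ropp_mult_distr_l_reverse, sinh_opp, cosh_opp, pow_opp_odd, Rinv_opp.
        f_equal. ring.
      - intros n. unfold tau. rewrite <- INR_IZR_INZ.
        replace (INR (S n) * PI / a) with (INR (S n) * (PI / a)) by (field; exact ha).
        apply cosh_sinh_pow_bound; [exact Hc | lia].
      - assert (E : forall n, odd_term l n =
          ((g (Z.of_nat (S n)) + RtoC (-1) * g (- Z.of_nat (S n))%Z)
           * RtoC (tau l (Z.of_nat (S n))))%C).
        { intros n. unfold odd_term, tau.
          rewrite <- INR_IZR_INZ, RtoC_div by (apply pow_nonzero, Hs).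
          unfold Cdiv. ring. }
        destruct P1 as [w Hw].
        assert (Hw' : is_series (odd_term l) w).
        { eapply is_series_C_ext; [|exact Hw]. intros n. now rewrite E. }
        split; [now exists w|].
        rewrite (CSeries_unique _ _ Hw'), <- (CSeries_unique _ _ Hw). exact P2. }
    split; [intros l Hl; now apply Hodd|].
    rewrite (sum_n_m_triangle_coef k 0 (fun l => INR (fact (2 * l)))
      (fun j l => (binom (2 * k) (2 * j) * INR (fact (2 * l))
                 - binom (2 * k) (2 * j + 1) * INR (fact (2 * l + 1))) * Sjl j l)).
    2:{ intros j l Hl. unfold coth_weight. rewrite (Nat.add_1_r (2 * l)), INR_fact_S. ring. }
    (* The [l = 0] series need not converge, but its coefficient vanishes. *)
    rewrite (sum_Sn_m _ 0 k) by lia.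
    assert (b0 : coth_coef k 0 = 0) by (destruct k; [lia | apply coth_coef_succ_0]).
    rewrite b0, Rmult_0_r, Cmult_0_l.
    rewrite (plus_zero_l (G := C_AbelianMonoid)).
    exists (fun m => (RtoC (PI ^ (2 * k + 1) / (a ^ (2 * k + 1) * INR (fact (2 * k))))
      * sum_n_m (fun l => (RtoC (INR (fact (2 * l)) * coth_coef k l)
                           * (g m * RtoC (tau l m)))%C) 1 k)%C).
    split.
    + intros m Hm.
      rewrite (sum_n_m_ext _ (fun l => (RtoC (INR (fact (2 * l)) * coth_coef k l
        * tau l m) * g m)%C)) by (intros l; apply RtoC_mult_swap).
      rewrite sum_n_m_RtoC_mult. unfold tau. rewrite <- coth_even_sum by exact hk.
      assert (H := is_series_Z_scal (g m * RtoC ((PI / a) ^ (2 * k + 1))) _ _ _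
        (fun n => lattice_term g a (2 * k + 1) m n ha Hm)
        (series_Z_odd k _ hk (Hx m Hm))).
      replace (RtoC _ * (RtoC _ * g m))%C with
        (g m * RtoC ((PI / a) ^ (2 * k + 1)) *
         RtoC (coth_even k (IZR m * PI / a) / INR (fact (2 * k))))%C; [exact H|].
      rewrite <- Cmult_assoc, <- RtoC_mult, Cmult_comm, Cmult_assoc, <- RtoC_mult.
      do 2 f_equal. unfold Rdiv. rewrite Rpow_mult_distr, pow_inv, Rinv_mult. ring.
    + eapply is_series_Znz_scal; [intros m; reflexivity|].
      apply (is_series_Znz_sum (fun l m => (RtoC (INR (fact (2 * l)) * coth_coef k l)
                           * (g m * RtoC (tau l m)))%C)); [exact hk|].
      intros l Hl. eapply is_series_Znz_scal; [intros m; reflexivity|].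
      now apply Hodd.
Qed.
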